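(* Let $\Theta\in\mathbb{R}^{N\times N}$ be a (symmetric) positive-definite matrix, let $I=\{1,\dots,N\}$, and let $S\subset I\times I$ be a lower-triangular sparsity set (that is, $(i,j)\in S$ implies $i\ge j$) containing all diagonal pairs $(i,i)$. Let $\mathcal{S}=\{A\in\mathbb{R}^{N\times N}: A_{ij}\neq 0\Rightarrow (i,j)\in S\}$ and let $$L=\operatorname*{argmin}_{\hat L\in\mathcal{S}}\ \mathbb{D}_{\mathrm{KL}}\big(\mathcal{N}(0,\Theta)\,\|\,\mathcal{N}(0,(\hat L\hat L^{\top})^{-1})\big).$$ For $i\in I$ put $s_i=\{j:(j,i)\in S\}$, listed in increasing order (so that its first element is $i$). Then the nonzero entries of the $i$-th column of $L$ are given by $$L_{s_i,i}=\frac{\Theta_{s_i,s_i}^{-1}\mathbf{e}_1}{\sqrt{\mathbf{e}_1^{\top}\Theta_{s_i,s_i}^{-1}\mathbf{e}_1}}.$$ Using this formula, $L$ can be computed in computational complexity $O\big(\#S+(\max_{1\le i\le N}\#s_i)^2\big)$ in space and $O\big(\sum_{i=1}^N(\#s_i)^3\big)$ in time.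
   Context: $\mathcal{N}(0,\Sigma)$ is the centered Gaussian distribution on $\mathbb{R}^N$ with covariance matrix $\Sigma$. The Kullback-Leibler divergence is $\mathbb{D}_{\mathrm{KL}}(P\|Q)=\int\log(dP/dQ)\,dP$; for centered Gaussians, $2\,\mathbb{D}_{\mathrm{KL}}(\mathcal{N}(0,\Theta_1)\|\mathcal{N}(0,\Theta_2))=\operatorname{trace}(\Theta_2^{-1}\Theta_1)+\log\det\Theta_2-\log\det\Theta_1-N$. $\Theta_{s_i,s_i}$ is the restriction of $\Theta$ to rows and columns with indices in $s_i$, and $\Theta_{s_i,s_i}^{-1}:=(\Theta_{s_i,s_i})^{-1}$. $L_{s_i,i}$ is the vector of entries of the $i$-th column of $L$ with row indices in $s_i$. $\mathbf{e}_1\in\mathbb{R}^{\#s_i}$ is the vector with first entry equal to one and all other entries equal to zero. $\#$ denotes cardinality.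
   Formalization: The argmin is unique only up to signs of columns (N=1, Θ=1: L=1 and L=-1 both minimize), so L is taken with positive diagonal, all minimizers being its column sign flips; the argmin ranges over invertible L̂, and the complexity bounds are for N≥1. *)

(* Defs.v *)
(* MathComp / MathComp-Analysis *)
From HB Require Import structures.
From mathcomp Require Import all_boot all_order all_algebra.
From mathcomp Require Import all_classical all_reals all_analysis.
From mathcomp Require Import measurable_realfun.

Set Implicit Arguments.
Unset Strict Implicit.
Unset Printing Implicit Defensive.

Import Order.TTheory GRing.Theory Num.Theory.
Import numFieldNormedType.Exports.

Local Open Scope classical_set_scope.
Local Open Scope ring_scope.

(** * Centered Gaussian distributions on R^N and Kullback-Leibler divergence *)

Section gaussian.
Context {R : realType}.

Definition tcons n (x : measurableTypeR R * n.-tuple (measurableTypeR R)) :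
  n.+1.-tuple (measurableTypeR R) := [tuple of x.1 :: x.2].

Lemma measurable_tcons n : measurable_fun setT (@tcons n).
Proof. exact: measurable_cons. Qed.

HB.instance Definition _ n := isMeasurableFun.Build _ _ _ _ (@tcons n)
  (@measurable_tcons n).

Fixpoint std_normal n : probability (n.-tuple (measurableTypeR R)) R :=
  if n is n'.+1 then distribution (normal_prob 0 1 \x std_normal n')%E (@tcons n')
  else \d_ [tuple].

Definition tmulmx N (A : 'M[R]_N) (x : N.-tuple (measurableTypeR R)) :
    N.-tuple (measurableTypeR R) :=
  [tuple \sum_(j < N) A i j * tnth x j | i < N].

Lemma measurable_tmulmx N (A : 'M[R]_N) : measurable_fun setT (tmulmx A).
Proof.
apply/measurable_fun_tnthP => i.
rewrite (_ : _ \o _ = fun x => \sum_(j < N) A i j * tnth x j); last first.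
  by apply/funext => x /=; rewrite tnth_mktuple.
apply: measurable_sum => j; apply: (measurableT_comp (mulrl_measurable _)).
exact: (@measurable_tnth _ (measurableTypeR R)).
Qed.

HB.instance Definition _ N (A : 'M[R]_N) :=
  isMeasurableFun.Build _ _ _ _ (tmulmx A) (measurable_tmulmx A).

(* A lower-triangular A with A A^T = Sigma exists whenever Sigma is symmetric
   positive semidefinite; the law of A Z, for Z standard normal, does not
   depend on the choice of A. *)
Definition gaussian N (Sigma : 'M[R]_N) :
    probability (N.-tuple (measurableTypeR R)) R :=
  distribution (std_normal N)
    (tmulmx (xget 0 [set A : 'M[R]_N | is_trig_mx A /\ A *m A^T = Sigma])).

Local Open Scope ereal_scope.
Local Open Scope charge_scope.

Definition KL d (T : measurableType d) (P Q : probability T R) : \bar R :=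
  if `[< P `<< Q >] then
    \int[P]_x lne (('d (charge_of_finite_measure P) '/d Q) x)
  else +oo.

End gaussian.

(** * Sparse factors of the precision matrix *)

Section factor.
Context {R : realType}.
Variable N : nat.
Implicit Types (Theta L : 'M[R]_N) (S : {set 'I_N * 'I_N}).

Definition posdefmx Theta : Prop :=
  Theta^T = Theta /\
  forall x : 'cV[R]_N, x != 0 -> 0 < (x^T *m Theta *m x) 0 0.

(* (i, j) \in S implies i >= j, and S contains the diagonal. *)
Definition lower_sparsity S : Prop :=
  (forall i j, (i, j) \in S -> (j <= i)%N) /\ (forall i, (i, i) \in S).

Definition sparse S L : Prop := forall i j, L i j != 0 -> (i, j) \in S.

Definition KLobj Theta L : \bar R :=
  KL (gaussian Theta) (gaussian (invmx (L *m L^T))).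

(* The minimum is over the factors for which (L L^T)^-1 exists. *)
Definition KLargmin Theta S L : Prop :=
  [/\ sparse S L, L \in unitmx &
      forall L', sparse S L' -> L' \in unitmx ->
        (KLobj Theta L <= KLobj Theta L')%E].

Definition scol S (i : 'I_N) : {set 'I_N} := [set j | (j, i) \in S].

(* enum_val lists the elements of a subset of 'I_N in increasing order. *)
Definition submx_set Theta (s : {set 'I_N}) : 'M[R]_#|s| :=
  mxsub (@enum_val _ (mem s)) (@enum_val _ (mem s)) Theta.

Definition subcol L (s : {set 'I_N}) (i : 'I_N) : 'cV[R]_#|s| :=
  \col_k L (enum_val k) i.

Definition e1 n : 'cV[R]_n := \col_k (val k == 0%N)%:R.

Definition KLcol Theta S (i : 'I_N) : 'cV[R]_#|scol S i| :=
  let T := invmx (submx_set Theta (scol S i)) in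
  (Num.sqrt (((e1 _)^T *m T *m e1 _) 0 0))^-1 *: (T *m e1 _).

End factor.

(** * A real random-access machine

   A program has integer registers, used for indexing and loop control, and an
   array of real cells addressed by integer expressions. Its input (N, the
   entries of Theta, the sizes and elements of the s_i) is random-access and
   read-only; it does not count as space, whereas the output does. Cells and
   registers are initially 0 and hold one number each. Every node of an evaluated expression, every assignment and every
   loop iteration takes unit time. There is no test on real values, and the
   only control structure is the bounded loop, so every program terminates. *)

Inductive iexp :=
  | IReg of nat
  | ICst of nat
  | IDim                  (* N *)
  | ISize of iexp         (* #s_i *)
  | IRow of iexp & iexp   (* element k (from 0) of s_i *)
  | IAdd of iexp & iexp
  | ISub of iexp & iexp
  | IMul of iexp & iexp.

Inductive rexp :=
  | RCst of nat
  | RMem of iexp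
  | RTheta of iexp & iexp
  | RAdd of rexp & rexp
  | RSub of rexp & rexp
  | RMul of rexp & rexp
  | RDiv of rexp & rexp
  | RSqrt of rexp.

Inductive cmd :=
  | CReg of nat & iexp
  | CMem of iexp & rexp
  | CSeq of cmd & cmd
  | CFor of nat & iexp & cmd.   (* CFor x n c: for x = 0, ..., n - 1 do c *)

(* rspace and mspace are one plus the largest register, resp. cell, written. *)
Record state (R : Type) := State {
  reg : nat -> nat; cell : nat -> R; time_used : nat; rspace : nat; mspace : nat }.

Section machine.
Context {R : realType}.
Variables (N : nat) (Theta : 'M[R]_N) (S : {set 'I_N * 'I_N}).
Implicit Types st : state R.

(* Accesses out of range return 0. *)
Definition in_row (i : nat) : seq nat :=
  if insub i is Some i' then [seq val j | j <- enum (scol S i')] else [::].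

Definition in_entry (i j : nat) : R :=
  if (insub i, insub j) is (Some i', Some j') then Theta i' j' else 0.

Fixpoint ieval (r : nat -> nat) (e : iexp) : nat :=
  match e with
  | IReg x => r x
  | ICst n => n
  | IDim => N
  | ISize e1 => size (in_row (ieval r e1))
  | IRow e1 e2 => nth 0%N (in_row (ieval r e1)) (ieval r e2)
  | IAdd e1 e2 => ieval r e1 + ieval r e2
  | ISub e1 e2 => ieval r e1 - ieval r e2
  | IMul e1 e2 => ieval r e1 * ieval r e2
  end%N.

Fixpoint icost (e : iexp) : nat :=
  match e with
  | IReg _ | ICst _ | IDim => 1
  | ISize e1 => (icost e1).+1
  | IRow e1 e2 | IAdd e1 e2 | ISub e1 e2 | IMul e1 e2 =>
      (icost e1 + icost e2).+1
  end%N.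

Fixpoint reval (r : nat -> nat) (m : nat -> R) (e : rexp) : R :=
  match e with
  | RCst n => n%:R
  | RMem a => m (ieval r a)
  | RTheta i j => in_entry (ieval r i) (ieval r j)
  | RAdd e1 e2 => reval r m e1 + reval r m e2
  | RSub e1 e2 => reval r m e1 - reval r m e2
  | RMul e1 e2 => reval r m e1 * reval r m e2
  | RDiv e1 e2 => reval r m e1 / reval r m e2
  | RSqrt e1 => Num.sqrt (reval r m e1)
  end.

Fixpoint rcost (e : rexp) : nat :=
  match e with
  | RCst _ => 1
  | RMem a => (icost a).+1
  | RTheta i j => (icost i + icost j).+1
  | RAdd e1 e2 | RSub e1 e2 | RMul e1 e2 | RDiv e1 e2 =>
      (rcost e1 + rcost e2).+1
  | RSqrt e1 => (rcost e1).+1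
  end%N.

Definition set_reg st (x v cost : nat) : state R :=
  State [eta reg st with x |-> v] (cell st) (time_used st + cost)
    (maxn (rspace st) x.+1) (mspace st).

Definition set_mem st (a : nat) (v : R) (cost : nat) : state R :=
  State (reg st) [eta cell st with a |-> v] (time_used st + cost)
    (rspace st) (maxn (mspace st) a.+1).

Definition tick st (cost : nat) : state R :=
  State (reg st) (cell st) (time_used st + cost) (rspace st) (mspace st).

Fixpoint run (c : cmd) st : state R :=
  match c with
  | CReg x e => set_reg st x (ieval (reg st) e) (icost e).+1
  | CMem a e =>
      set_mem st (ieval (reg st) a) (reval (reg st) (cell st) e)
        (icost a + rcost e).+1
  | CSeq c1 c2 => run c2 (run c1 st)
  | CFor x n c1 =>
      foldl (fun st' k => run c1 (set_reg st' x k 1))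
        (tick st (icost n).+1) (iota 0 (ieval (reg st) n))
  end.

Definition init : state R := State (fun=> 0%N) (fun=> 0) 0 0 0.

Definition final (c : cmd) : state R := run c init.

Definition space_used st : nat := (rspace st + mspace st)%N.

(* Position of the first entry of column i when the entries L j i with
   (j, i) \in S are stored consecutively, column after column. *)
Definition col_start (i : 'I_N) : nat := (\sum_(j < N | j < i) #|scol S j|)%N.

Definition stores st (L : 'M[R]_N) : Prop :=
  forall (i : 'I_N) (k : 'I_#|scol S i|),
    cell st (col_start i + k)%N = L (enum_val k) i.

End machine.

(* Main.v *)
Require Import Defs.
From HB Require Import structures.
From mathcomp Require Import all_boot all_order all_algebra.
From mathcomp Require Import all_classical all_reals all_analysis.
From mathcomp Require Import measurable_realfun zify ring lra.

(** For lower triangular invertible matrices A and B and a standard normal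
vector Z, the divergence between the laws of A Z and B Z can be computed
exactly, and for the objective this gives
  (tr (L^T Theta L) - N) / 2 - ln |det L| - ln (det Theta) / 2     (KLobjE).
A sparse L is lower triangular, so its determinant is the product of its
diagonal entries, and up to a constant the objective is a sum of one term for
each column, l^T T l / 2 - ln |l_1|, where l is the restriction of the column
to s_i and T that of Theta (KLobj_colcost). Put u = T^-1 e1 and a = e1^T u, and
write l = d + (l_1 / a) u. Since T u = e1 and d has first entry 0, the two
summands are T-orthogonal: with t = l_1^2 / a, the cost of the column is
  d^T T d / 2 + (t - ln t) / 2 - (ln a) / 2.
Here d^T T d >= 0 and t - ln t >= 1, with equality exactly when d = 0 and
t = 1, that is, when l is u / sqrt a up to sign (colcost_min). The columns do
not interact, so this describes all minimizers (KLargminP).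

The closed form of the divergence rests on a change of variables. The Gaussian
substitution z -> c z + w on the line, iterated with Tonelli's theorem along
the rows of a triangular matrix (integral_std_normal_affine), gives the density
of one law with respect to the other. The logarithm of this density is a
quadratic polynomial, so that its integral only involves second moments. That
a standard normal variable has second moment 1 follows from the same
substitution: it evaluates the integral of exp ((1 - c^2) z^2 / 2) as 1 / c,
and 1 + y <= exp y then bounds the moment from above when c < 1 and from below
when c > 1, by bounds that meet as c tends to 1 (normal_m2).

The program treats the columns one after the other. It loads T and e1 into a
scratch matrix placed after the output written so far, solves T u = e1 by
Gauss-Jordan elimination without pivoting, and outputs the u_j / sqrt u_1. No
pivot vanishes, because the Schur complements of a positive definite matrix are
positive definite (gj_inv_step). For n = #s_i the elimination takes O(n^3)
steps and O(n^2) cells, and the cells are reused by the next column. *)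

Set Implicit Arguments.
Unset Strict Implicit.
Unset Printing Implicit Defensive.

Import Order.TTheory GRing.Theory Num.Theory.

Local Open Scope ring_scope.

(** * Densities and the Kullback-Leibler divergence *)

Section density.
Context {R : realType}.

(** The Radon-Nikodym derivative of nu has the same integral as h over every
measurable set, hence they agree m-almost everywhere. *)
Lemma integral_density d (T : measurableType d)
    (nu : {finite_measure set T -> \bar R})
    (m : {sigma_finite_measure set T -> \bar R}) (h f : T -> \bar R) :
  measurable_fun setT h -> (forall x, 0 <= h x)%E ->
  (forall A, measurable A -> nu A = \int[m]_(x in A) h x)%E ->
  measurable_fun setT f -> (forall x, 0 <= f x)%E ->
  (\int[nu]_x f x = \int[m]_x (f x * h x))%E.
Proof.
move=> mh h0 nuE mf f0.
have num : nu `<< m.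
  apply/null_content_dominatesP => A mA mA0; rewrite nuE//.
  by apply: null_set_integral => //; exact: measurable_funTS.
rewrite -(Radon_Nikodym_SigmaFinite.change_of_variables num)//.
have mRN := measurable_int _ (Radon_Nikodym_SigmaFinite.f_integrable num).
apply: ae_eq_integral => //.
- exact: emeasurable_funM.
- exact: emeasurable_funM.
apply: ae_eqe_mul2l; apply: integral_ae_eq => //.
- exact: Radon_Nikodym_SigmaFinite.f_integrable.
- by move=> A _ mA; rewrite -Radon_Nikodym_SigmaFinite.f_integral// nuE.
Qed.

End density.

(** * The standard normal law on the line *)

Section line.
Local Open Scope classical_set_scope.
Context {R : realType}.
Local Notation mu := (@lebesgue_measure R).
Local Notation gamma := (normal_prob (0 : R) 1).

Definition affR (c w : R) : measurableTypeR R -> measurableTypeR R :=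
  fun x : R => c * x + w.

Lemma measurable_affR c w : measurable_fun setT (affR c w).
Proof. by apply: measurable_funD => //; exact: measurable_funM. Qed.

(** This rescaled image of Lebesgue measure is Lebesgue measure itself; it is
built as a measure so that uniqueness of Lebesgue measure applies to it. *)
Definition affR_law (c w : R) : {measure set (measurableTypeR R) -> \bar R}.
Proof.
refine (mscale (NngNum (normr_ge0 c)) (pushforward mu (affR c w))).
exact: measurable_affR.
Defined.

Lemma affR_preimage_gt0 c w a b : 0 < c ->
  affR c w @^-1` `]a, b]%classic = `](a - w) / c, (b - w) / c]%classic.
Proof.
move=> c0; apply/seteqP; split => x /=; rewrite /affR !in_itv/=
  ltr_pdivrMr// ler_pdivlMr// ltrBlDr lerBrDr mulrC => //.
Qed.

Lemma affR_preimage_lt0 c w a b : c < 0 ->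
  affR c w @^-1` `]a, b]%classic = `[(b - w) / c, (a - w) / c[%classic.
Proof.
move=> c0; apply/seteqP; split => x /=; rewrite /affR !in_itv/=
  ler_ndivrMr// ltr_ndivlMr// ltrBlDr lerBrDr andbC mulrC => //.
Qed.

(** Half-open intervals determine Lebesgue measure, and their preimages are
intervals of length divided by |c|. *)
Lemma lebesgue_measure_affR c w (A : set (measurableTypeR R)) : c != 0 ->
  measurable A -> (mu A = `|c|%:E * mu (affR c w @^-1` A))%E.
Proof.
move=> c0 mA.
rewrite (@lebesgue_measure_unique R (affR_law c w))// => _ [[a b] _ <-] /=.
rewrite /affR_law /= /mscale /= -[pushforward _ _ _]/(mu (affR c w @^-1` _)).
have [c_gt0|c_lt0|/eqP] := ltrgtP 0 c; last by rewrite eq_sym (negbTE c0).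
  rewrite affR_preimage_gt0// !lebesgue_measure_itv/= !lte_fin.
  rewrite ltr_pM2r ?invr_gt0// ltrD2r gtr0_norm//.
  case: ifP => _; last by rewrite mule0.
  by rewrite -EFinM; congr EFin; field.
rewrite affR_preimage_lt0// !lebesgue_measure_itv/= !lte_fin.
rewrite ltr_nM2r ?invr_lt0// ltrD2r ltr0_norm//.
case: ifP => _; last by rewrite mule0.
by rewrite -EFinM; congr EFin; field.
Qed.

Lemma integral_affR (c w : R) (G : measurableTypeR R -> \bar R) : c != 0 ->
  measurable_fun setT G -> (forall x, 0 <= G x)%E ->
  (\int[mu]_x G x = `|c|%:E * \int[mu]_x G (c * (x : R) + w)%R)%E.
Proof.
move=> c0 mG G0.
rewrite (@eq_measure_integral _ _ _ _ (affR_law c w)); last first.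
  by move=> A mA _; exact: lebesgue_measure_affR.
rewrite ge0_integral_mscale//= ge0_integral_pushforward//=.
exact: measurable_affR.
Qed.

Lemma integral_normal (f : measurableTypeR R -> \bar R) :
  measurable_fun setT f -> (forall x, 0 <= f x)%E ->
  (\int[gamma]_x f x = \int[mu]_x (f x * (normal_pdf 0 1 (x : R))%:E))%E.
Proof.
move=> mf f0; apply: (@integral_density _ _ _ gamma mu
  (fun x => (normal_pdf 0 1 (x : R))%:E)) => //.
- by apply/measurable_EFinP; apply: measurable_normal_pdf.
- by move=> x; rewrite lee_fin normal_pdf_ge0.
Qed.

Lemma normal_pdf_affine (c w x : R) :
  normal_pdf 0 1 (c * x + w) =
  expR ((x ^+ 2 - (c * x + w) ^+ 2) / 2) * normal_pdf 0 1 x.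
Proof.
rewrite !normal_pdfE ?oner_eq0// /normal_fun mulrCA -expRD.
by congr (_ * expR _); field.
Qed.

(** Affine substitution in the Lebesgue integral: apart from |c|, the weight
is the ratio of the values of the normal density at c x + w and at x. *)
Lemma integral_normal_affine (c w : R) (f : measurableTypeR R -> \bar R) :
  c != 0 -> measurable_fun setT f -> (forall x, 0 <= f x)%E ->
  (\int[gamma]_x f x = \int[gamma]_x (f (c * (x : R) + w)%R *
    (`|c| * expR (((x : R) ^+ 2 - (c * (x : R) + w) ^+ 2) / 2))%:E))%E.
Proof.
move=> c0 mf f0.
have maff : measurable_fun setT (fun x : measurableTypeR R => c * (x : R) + w).
  exact: measurable_affR.
rewrite integral_normal// (integral_affR w c0)//; last 2 first.
- apply: emeasurable_funM => //.
  by apply/measurable_EFinP; apply: measurable_normal_pdf.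
- by move=> x; rewrite mule_ge0// lee_fin normal_pdf_ge0.
rewrite -ge0_integralZl//; last 2 first.
- apply: emeasurable_funM; first exact: (measurableT_comp mf).
  apply/measurable_EFinP; apply: measurableT_comp maff.
  exact: measurable_normal_pdf.
- by move=> x _; rewrite mule_ge0// lee_fin normal_pdf_ge0.
rewrite [RHS]integral_normal//; last 2 first.
- apply: emeasurable_funM; first exact: (measurableT_comp mf).
  apply/measurable_EFinP; apply: measurable_funM => //.
  apply: measurableT_comp => //; apply: measurable_funM => //.
  apply: measurable_funB; first exact: measurable_funX.
  exact: measurable_funX.
- by move=> x; rewrite mule_ge0// lee_fin mulr_ge0// expR_ge0.
apply: eq_integral => x _; rewrite normal_pdf_affine.
by rewrite muleCA -muleA -!EFinM mulrA.
Qed.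

Local Notation m2 := (\int[gamma]_x (((x : R) ^+ 2)%:E))%E.

Lemma measurable_sqrR :
  measurable_fun setT (fun x : measurableTypeR R => ((x : R) ^+ 2)%:E).
Proof. by apply/measurable_EFinP; exact: measurable_funX. Qed.

(** The substitution x -> c x applied to a constant function: its integral is
the total mass, 1, and the weight is a Gaussian exponential. *)
Lemma integral_expR_sqr (c : R) : 0 < c ->
  (\int[gamma]_x (expR ((1 - c ^+ 2) / 2 * (x : R) ^+ 2))%:E = (c^-1)%:E)%E.
Proof.
move=> c0.
have := @integral_normal_affine c 0 (cst 1%E).
rewrite integral_cst//= probability_setT mule1 => /(_ (lt0r_neq0 c0)).
under eq_integral do rewrite mul1e EFinM.
rewrite ge0_integralZl//=; last first.
  apply/measurable_EFinP/measurableT_comp => //; apply: measurable_funM => //.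
  apply: measurable_funB; first exact: measurable_funX.
  apply: measurable_funX; exact: measurable_affR.
have -> : (\int[gamma]_x (expR (((x : R) ^+ 2 - (c * (x : R) + 0) ^+ 2) / 2))%:E
    = \int[gamma]_x (expR ((1 - c ^+ 2) / 2 * (x : R) ^+ 2))%:E)%E.
  by apply: eq_integral => x _; congr (expR _)%:E; field.
rewrite gtr0_norm// => /(_ (@measurable_cst _ _ _ _ _ _)) /(_ (fun=> lee01)) h.
set I := (X in X = _); rewrite -/I in h.
have : (c^-1%:E * 1 = c^-1%:E * (c%:E * I))%E by rewrite -h.
by rewrite mule1 muleA -EFinM mulVf ?mul1e ?lt0r_neq0.
Qed.

(** Integrate 1 + y <= exp y at y = (1 - c^2) x^2 / 2. *)
Lemma normal_m2_le (c : R) : 0 < c < 1 -> (m2 <= (2 / (c * (1 + c)))%:E)%E.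
Proof.
move=> /andP[c0 c1].
have k0 : 0 < (1 - c ^+ 2) / 2 by nra.
have mexp : measurable_fun setT (fun x : measurableTypeR R =>
    (expR ((1 - c ^+ 2) / 2 * (x : R) ^+ 2))%:E).
  by apply/measurable_EFinP/measurableT_comp => //; apply: measurable_funM.
have : (\int[gamma]_x (1 + ((1 - c ^+ 2) / 2)%:E * ((x : R) ^+ 2)%:E) <=
        (c^-1)%:E)%E.
  rewrite -integral_expR_sqr//; apply: ge0_le_integral => //.
  - by move=> x _; rewrite -EFinM -EFinD lee_fin addr_ge0//
      mulr_ge0 ?sqr_ge0// ltW.
  - apply: emeasurable_funD => //; apply: emeasurable_funM => //.
    exact: measurable_sqrR.
  - by move=> x _; rewrite -EFinM -EFinD lee_fin expR_ge1Dx.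
rewrite ge0_integralD//; last 2 first.
- by move=> x _; rewrite -EFinM lee_fin mulr_ge0 ?sqr_ge0// ltW.
- apply: emeasurable_funM => //; exact: measurable_sqrR.
rewrite integral_cst//= probability_setT mule1 ge0_integralZl//=; last 3 first.
- exact: measurable_sqrR.
- by move=> x _; rewrite lee_fin sqr_ge0.
- by rewrite lee_fin ltW.
have : (0 <= m2)%E by apply: integral_ge0 => x _; rewrite lee_fin sqr_ge0.
case: m2 => [r| |]//=; last by rewrite gt0_muley// lte_fin.
rewrite -EFinM -EFinD !lee_fin => r0 h.
have c2 : 0 < c * (1 + c) by nra.
rewrite ler_pdivlMr//.
have {}h : (1 + (1 - c ^+ 2) / 2 * r) * c <= 1.
  by rewrite -[leRHS](mulVf (lt0r_neq0 c0)) ler_pM2r.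
have : (1 - c) * (r * (c * (1 + c)) - 2) <= 0 by nra.
by rewrite pmulr_rle0 ?subr_gt0// subr_le0.
Qed.

(** Integrate 1 <= exp y - y at y = (1 - c^2) x^2 / 2; as c > 1, both exp y
and - y are nonnegative, so that no integrability is needed. *)
Lemma normal_m2_ge (c : R) : 1 < c -> ((2 / (c * (1 + c)))%:E <= m2)%E.
Proof.
move=> c1; have c0 : 0 < c by lra.
have k0 : 0 < (c ^+ 2 - 1) / 2 by nra.
have mexp : measurable_fun setT (fun x : measurableTypeR R =>
    (expR ((1 - c ^+ 2) / 2 * (x : R) ^+ 2))%:E).
  by apply/measurable_EFinP/measurableT_comp => //; apply: measurable_funM.
have : (1 <= \int[gamma]_x ((expR ((1 - c ^+ 2) / 2 * (x : R) ^+ 2))%:E +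
      ((c ^+ 2 - 1) / 2)%:E * ((x : R) ^+ 2)%:E))%E.
  rewrite -[leLHS](_ : (\int[gamma]_x (cst 1 x) = 1)%E); last first.
    by rewrite integral_cst//= probability_setT mule1.
  apply: ge0_le_integral => //.
  - apply: emeasurable_funD => //; apply: emeasurable_funM => //.
    exact: measurable_sqrR.
  - move=> x _; rewrite -EFinM -EFinD lee_fin.
    have := expR_ge1Dx ((1 - c ^+ 2) / 2 * (x : R) ^+ 2); lra.
rewrite ge0_integralD//; last 2 first.
- by move=> x _; rewrite -EFinM lee_fin mulr_ge0 ?sqr_ge0// ltW.
- apply: emeasurable_funM => //; exact: measurable_sqrR.
rewrite integral_expR_sqr// ge0_integralZl//=; last 3 first.
- exact: measurable_sqrR.
- by move=> x _; rewrite lee_fin sqr_ge0.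
- by rewrite lee_fin ltW.
have : (0 <= m2)%E by apply: integral_ge0 => x _; rewrite lee_fin sqr_ge0.
case: m2 => [r| |]//=; last by move=> _ _; rewrite leey.
rewrite -EFinM -EFinD !lee_fin => r0 h.
have c2 : 0 < c * (1 + c) by nra.
rewrite ler_pdivrMr//.
have {}h : 1 * c <= (c^-1 + (c ^+ 2 - 1) / 2 * r) * c by rewrite ler_pM2r.
rewrite mulrDl mulVf ?lt0r_neq0// in h.
have : 0 <= (c - 1) * (r * (c * (1 + c)) - 2) by nra.
by rewrite pmulr_rge0 ?subr_gt0// subr_ge0.
Qed.

Lemma normal_m2 : (m2 = 1)%E.
Proof.
have m20 : (0 <= m2)%E by apply: integral_ge0 => x _; rewrite lee_fin sqr_ge0.
have := @normal_m2_le 2^-1.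
have := normal_m2_le; have := normal_m2_ge; move: m20.
case: m2 => [r| |]//=; last by move=> _ _ _ /(_ _)/wrap[]//; lra.
rewrite lee_fin => r0 hge hle _.
have r1 : 0 < r + 1 by lra.
(* If r > 1 then c < 1, and the upper bound at c reduces to r <= 1;
   if r < 1 then c > 1, and the lower bound at c reduces to r >= 1. *)
set c := 2 / (r + 1).
have cE : c * (r + 1) = 2 by rewrite /c mulfVK ?lt0r_neq0.
have c0 : 0 < c by rewrite divr_gt0.
congr EFin; apply/eqP; rewrite eq_le; apply/andP; split;
  rewrite leNgt; apply/negP.
- move=> r_gt1; have : c < 1 by rewrite /c ltr_pdivrMr//; lra.
  move=> c1; have := hle c; rewrite c0 c1 => /(_ isT).
  rewrite lee_fin ler_pdivlMr; nra.
- move=> r_lt1; have : 1 < c by rewrite /c ltr_pdivlMr//; lra.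
  move=> c1; have := hge c c1.
  rewrite lee_fin ler_pdivrMr; nra.
Qed.

End line.

(** * Triangular changes of variables for the standard normal law *)

Section space.
Local Open Scope classical_set_scope.
Context {R : realType}.
Local Notation gamma := (normal_prob (0 : R) 1).
Local Notation tup n := (n.-tuple (measurableTypeR R)).
Implicit Type n : nat.

Definition sqnorm n (x : tup n) : R := \sum_(i < n) (tnth x i : R) ^+ 2.

(** The linear part is a function rather than a matrix, so that the first row
and the first column can be split off without casts. *)
Definition taff n (C : 'I_n -> 'I_n -> R) (w : 'I_n -> R) (x : tup n) : tup n :=
  [tuple \sum_(j < n) C i j * tnth x j + w i | i < n].

Lemma measurable_sqnorm n : measurable_fun setT (@sqnorm n).
Proof.
apply: measurable_sum => i; apply: measurable_funX.
exact: (@measurable_tnth _ (measurableTypeR R)).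
Qed.

Lemma measurable_taff n C w : measurable_fun setT (@taff n C w).
Proof.
apply/measurable_fun_tnthP => i.
rewrite (_ : _ \o _ = fun x => \sum_(j < n) C i j * tnth x j + w i); last first.
  by apply/funext => x /=; rewrite tnth_mktuple.
apply: measurable_funD => //; apply: measurable_sum => j.
apply: (measurableT_comp (mulrl_measurable _)).
exact: (@measurable_tnth _ (measurableTypeR R)).
Qed.

Lemma sqnorm_cons n (x : measurableTypeR R) (y : tup n) :
  sqnorm [tuple of x :: y] = (x : R) ^+ 2 + sqnorm y.
Proof.
rewrite /sqnorm big_ord_recl tnth0; congr +%R.
by apply: eq_bigr => i _; rewrite tnthS.
Qed.

Lemma taff_cons n C w (x : measurableTypeR R) (y : tup n) :
  (forall i j : 'I_n.+1, (i < j)%N -> C i j = 0) ->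
  taff C w [tuple of x :: y] =
  [tuple of (C ord0 ord0 * (x : R) + w ord0 : measurableTypeR R) ::
    taff (fun i j => C (lift ord0 i) (lift ord0 j))
      (fun i => C (lift ord0 i) ord0 * (x : R) + w (lift ord0 i)) y].
Proof.
move=> trigC; apply: eq_from_tnth => i; rewrite tnth_mktuple big_ord_recl tnth0.
under eq_bigr do rewrite tnthS.
case: (unliftP ord0 i) => [j|] ->.
  by rewrite tnthS tnth_mktuple addrA; congr (_ + _); rewrite addrC.
rewrite tnth0 big1 ?addr0// => j _; rewrite trigC ?mul0r//.
Qed.

(** Jacobian of z -> C z + w relative to the standard normal law instead of
Lebesgue measure. The product is the determinant of a triangular C. *)
Definition affine_jac n C w (z : tup n) : R :=
  `|\prod_(i < n) C i i| * expR ((sqnorm z - sqnorm (taff C w z)) / 2).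

Lemma affine_jac_ge0 n C w (z : tup n) : 0 <= affine_jac C w z.
Proof. by rewrite mulr_ge0// expR_ge0. Qed.

Lemma measurable_affine_jac n C w : measurable_fun setT (@affine_jac n C w).
Proof.
apply: measurable_funM => //; apply: measurableT_comp => //.
apply: measurable_funM => //; apply: measurable_funB.
  exact: measurable_sqnorm.
by apply: measurableT_comp (measurable_taff _ _); exact: measurable_sqnorm.
Qed.

Lemma integral_std_normalS n (f : tup n.+1 -> \bar R) :
  measurable_fun setT f -> (forall x, 0 <= f x)%E ->
  (\int[std_normal n.+1]_z f z = \int[gamma \x std_normal n]_p f (tcons p))%E.
Proof. by move=> mf f0; rewrite ge0_integral_distribution. Qed.

(** Induction on the dimension, splitting off the first coordinate x. For
fixed x the other coordinates undergo a triangular affine map whose shift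
depends on x (hence the shift w in the statement), and x itself undergoes an
affine map of the line. Tonelli's theorem puts either of them in the inner
integral. *)
Lemma integral_std_normal_affine n C w (f : tup n -> \bar R) :
  (forall i j : 'I_n, (i < j)%N -> C i j = 0) ->
  (forall i : 'I_n, C i i != 0) ->
  measurable_fun setT f -> (forall x, 0 <= f x)%E ->
  (\int[std_normal n]_z f z =
   \int[std_normal n]_z (f (taff C w z) * (affine_jac C w z)%:E))%E.
Proof.
elim: n => [|n IH] in C w f *; move=> trigC diagC mf f0.
  apply: eq_integral => z _; rewrite /affine_jac /sqnorm !big_ord0.
  rewrite normr1 subrr mul0r expR0 mulr1 mule1.
  by rewrite [z]tuple0 [taff _ _ _]tuple0.
pose c := C ord0 ord0; pose w0 := w ord0.
pose C' (i j : 'I_n) := C (lift ord0 i) (lift ord0 j).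
pose w' (x : R) (i : 'I_n) := C (lift ord0 i) ord0 * x + w (lift ord0 i).
pose k (x : R) := `|c| * expR ((x ^+ 2 - (c * x + w0) ^+ 2) / 2).
have jacE (x : measurableTypeR R) (y : tup n) :
    affine_jac C w [tuple of x :: y] = k x * affine_jac C' (w' x) y.
  rewrite /affine_jac taff_cons// !sqnorm_cons big_ord_recl normrM.
  by rewrite mulrACA -expRD; congr (_ * expR _); rewrite /c /w0; field.
have mjac := measurable_affine_jac C w.
have mcons (x : measurableTypeR R) :
    measurable_fun setT (fun y : tup n => [tuple of x :: y]).
  exact: measurable_cons.
have mtc : measurable_fun setT (@tcons R n) by exact: measurable_tcons.
have mF : measurable_fun setT
    (fun z => f (taff C w z) * (affine_jac C w z)%:E)%E.
  apply: emeasurable_funM; last exact/measurable_EFinP.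
  exact: measurableT_comp mf (measurable_taff _ _).
have mk : measurable_fun setT k.
  apply: measurable_funM => //; apply: measurableT_comp => //.
  apply: measurable_funM => //.
  apply: measurable_funB; apply: measurable_funX => //.
  exact: measurable_affR.
have k0 x : 0 <= k x by rewrite mulr_ge0// expR_ge0.
pose G (p : measurableTypeR R * tup n) : \bar R :=
  ((k p.1)%:E *
    f [tuple of (c * (p.1 : R) + w0 : measurableTypeR R)%R :: p.2])%E.
have mG : measurable_fun setT G.
  apply: emeasurable_funM.
    by apply/measurable_EFinP; exact: (measurableT_comp mk).
  apply: measurableT_comp mf _; apply: measurable_cons => //.
  apply: (measurableT_comp (measurable_affR c w0)).
  exact: measurable_fst.
have G0 p : (0 <= G p)%E by rewrite mule_ge0// lee_fin.
have fubG1 : (\int[gamma \x std_normal n]_p G p =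
    \int[gamma]_x fubini_F (std_normal n) G x)%E.
  by apply: fubini_tonelli1.
have fubG2 : (\int[gamma \x std_normal n]_p G p =
    \int[std_normal n]_y fubini_G gamma G y)%E.
  by apply: fubini_tonelli2.
transitivity (\int[gamma \x std_normal n]_p G p)%E; last first.
  have F0 z : (0 <= f (taff C w z) * (affine_jac C w z)%:E)%E.
    by rewrite mule_ge0// lee_fin affine_jac_ge0.
  have mFt := measurableT_comp mF mtc.
  rewrite (integral_std_normalS mF F0).
  pose H p := (f (taff C w (tcons p)) * (affine_jac C w (tcons p))%:E)%E.
  have -> : (\int[gamma \x std_normal n]_p H p =
      \int[gamma]_x fubini_F (std_normal n) H x)%E.
    by apply: fubini_tonelli1 => // p; exact: F0.
  rewrite fubG1; apply: eq_integral => x _.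
  rewrite /fubini_F /G /H /=.
  rewrite ge0_integralZl//; last 2 first.
  - apply: measurableT_comp mf _; exact: mcons.
  - by rewrite lee_fin.
  rewrite (IH C' (w' x)); last first.
  - by [].
  - exact: measurableT_comp mf (mcons _).
  - by move=> i; rewrite /C'.
  - by move=> i j ij; rewrite /C' trigC.
  rewrite -ge0_integralZl//; last 3 first.
  - apply: emeasurable_funM.
      have mfx := measurableT_comp mf (mcons (c * (x : R) + w0)).
      exact: measurableT_comp mfx (measurable_taff _ _).
    by apply/measurable_EFinP; exact: measurable_affine_jac.
  - by move=> y _; rewrite mule_ge0// lee_fin affine_jac_ge0.
  - by rewrite lee_fin.
  apply: eq_integral => y _; rewrite /tcons /= jacE taff_cons//.
  by rewrite EFinM muleCA.
rewrite (integral_std_normalS mf f0).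
have -> : (\int[gamma \x std_normal n]_p f (tcons p) =
    \int[std_normal n]_y fubini_G gamma (f \o @tcons R n) y)%E.
  apply: fubini_tonelli2 => //; exact: measurableT_comp mf mtc.
rewrite fubG2; apply: eq_integral => y _.
rewrite /fubini_G /G /tcons /=.
rewrite (@integral_normal_affine _ c w0)//; last first.
  apply: measurableT_comp mf _; exact: measurable_cons.
  exact: diagC.
by apply: eq_integral => x _; rewrite muleC.
Qed.

End space.

(** * Second moments of the standard normal law *)

Section moments.
Local Open Scope classical_set_scope.
Context {R : realType}.
Local Notation gamma := (normal_prob (0 : R) 1).
Local Notation tup n := (n.-tuple (measurableTypeR R)).
Implicit Type n : nat.

(** Averaging with the image under x -> - x cancels the term that is linear in
x while all integrands stay nonnegative. *)
Lemma integral_normal_sqr_affine (a b : R) :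
  (\int[gamma]_x ((b * (x : R) + a) ^+ 2)%:E = (a ^+ 2 + b ^+ 2)%:E)%E.
Proof.
pose f (x : measurableTypeR R) : \bar R := ((b * (x : R) + a) ^+ 2)%:E.
have mf : measurable_fun setT f.
  by apply/measurable_EFinP; apply: measurable_funX; exact: measurable_affR.
have f0 x : (0 <= f x)%E by rewrite lee_fin sqr_ge0.
have fN : (\int[gamma]_x f x = \int[gamma]_x f (-1 * (x : R) + 0)%R)%E.
  rewrite (@integral_normal_affine _ (-1) 0)// ?oppr_eq0 ?oner_eq0//.
  apply: eq_integral => x _; rewrite normrN1 mul1r.
  rewrite (_ : (_ - _) / 2 = 0 :> R) ?expR0 ?mule1//.
  by field.
have mfN : measurable_fun setT
    (fun x : measurableTypeR R => f (-1 * (x : R) + 0)%R).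
  exact: measurableT_comp mf (measurable_affR _ _).
have : (\int[gamma]_x f x + \int[gamma]_x f x = (2 * (a ^+ 2 + b ^+ 2))%:E)%E.
  rewrite [X in (_ + X)%E]fN -ge0_integralD//.
  transitivity (\int[gamma]_x ((2 * a ^+ 2)%:E +
      (2 * b ^+ 2)%:E * ((x : R) ^+ 2)%:E))%E.
    by apply: eq_integral => x _; rewrite /f -EFinM -!EFinD; congr EFin; ring.
  have k0 : 0 <= 2 * b ^+ 2 by rewrite mulr_ge0 ?sqr_ge0.
  rewrite ge0_integralD//; last 3 first.
  - by move=> x _; rewrite lee_fin mulr_ge0 ?sqr_ge0.
  - by move=> x _; rewrite -EFinM lee_fin mulr_ge0 ?sqr_ge0.
  - by apply: emeasurable_funM => //; exact: measurable_sqrR.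
  rewrite integral_cst//= probability_setT mule1.
  rewrite ge0_integralZl//=; last 2 first.
  - exact: measurable_sqrR.
  - by move=> x _; rewrite lee_fin sqr_ge0.
  by rewrite normal_m2 mule1 -EFinD mulrDr.
have : (0 <= \int[gamma]_x f x)%E by exact: integral_ge0.
rewrite -/f; case: (integral _ _ f) => [r| |]//= r0.
by rewrite -EFinD => -[h]; congr EFin; lra.
Qed.

(** The constant a is what makes the induction work: when the first coordinate
x is fixed, r_0 x + a takes its place. *)
Lemma integral_std_normal_sqr_affine n (r : 'I_n -> R) (a : R) :
  (\int[std_normal n]_z ((\sum_(j < n) r j * tnth z j + a) ^+ 2)%:E =
   (a ^+ 2 + \sum_(j < n) r j ^+ 2)%:E)%E.
Proof.
have mlin m (s : 'I_m -> R) : measurable_fun setT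
    (fun z : tup m => \sum_(j < m) s j * (tnth z j : R)).
  apply: measurable_sum => j; apply: (measurableT_comp (mulrl_measurable _)).
  exact: (@measurable_tnth _ (measurableTypeR R)).
elim: n => [|n IH] in r a *.
  under eq_integral do rewrite big_ord0 add0r.
  by rewrite big_ord0 addr0 integral_cst//= probability_setT mule1.
have mf : measurable_fun setT (fun z : tup n.+1 =>
    ((\sum_(j < n.+1) r j * tnth z j + a) ^+ 2)%:E).
  apply/measurable_EFinP; apply: measurable_funX.
  apply: (measurable_funD (g := cst a)
    (f := fun z : tup n.+1 => \sum_(j < n.+1) r j * (tnth z j : R))) => //.
  exact: mlin.
have f0 (z : tup n.+1) :
    (0 <= ((\sum_(j < n.+1) r j * tnth z j + a) ^+ 2)%:E)%E.
  by rewrite lee_fin sqr_ge0.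
rewrite (integral_std_normalS mf f0).
have mft := measurableT_comp mf (@measurable_tcons R n).
pose H p := ((\sum_(j < n.+1) r j * tnth (@tcons R n p) j + a) ^+ 2)%:E.
have -> : (\int[gamma \x std_normal n]_p H p =
    \int[gamma]_x fubini_F (std_normal n) H x)%E.
  by apply: fubini_tonelli1 => // p; exact: f0.
have s0 : 0 <= \sum_(j < n) r (lift ord0 j) ^+ 2.
  by apply: sumr_ge0 => j _; rewrite sqr_ge0.
transitivity (\int[gamma]_x (((r ord0 * (x : R) + a) ^+ 2)%:E +
    (\sum_(j < n) r (lift ord0 j) ^+ 2)%:E))%E.
  apply: eq_integral => x _; rewrite -EFinD -IH /fubini_F.
  apply: eq_integral => y _; rewrite /H /tcons /= big_ord_recl tnth0.
  rewrite (eq_bigr (fun j => r (lift ord0 j) * (tnth y j : R))); last first.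
    by move=> j _; congr (_ * _); exact: tnthS.
  by congr (_ ^+ 2)%:E; ring.
rewrite ge0_integralD//; last 2 first.
- by move=> x _; rewrite lee_fin sqr_ge0.
- by apply/measurable_EFinP; apply: measurable_funX; exact: measurable_affR.
rewrite integral_normal_sqr_affine integral_cst//= probability_setT mule1.
by rewrite -EFinD big_ord_recl addrA.
Qed.

Definition sqfro n (M : 'M[R]_n) : R := \sum_(i < n) \sum_(j < n) M i j ^+ 2.

Lemma integral_std_normal_sqnorm n (M : 'M[R]_n) :
  (\int[std_normal n]_z (sqnorm (tmulmx M z))%:E = (sqfro M)%:E)%E.
Proof.
rewrite /sqnorm; under eq_integral do rewrite -sumEFin.
rewrite ge0_integral_sum//; last 2 first.
- move=> i; apply/measurable_EFinP/measurable_funX.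
  apply: (measurableT_comp (f := fun x : tup n => tnth x i : R)).
    exact: (@measurable_tnth _ (measurableTypeR R)).
  exact: measurable_tmulmx.
- by move=> i x _; rewrite lee_fin sqr_ge0.
rewrite -sumEFin; apply: eq_bigr => i _.
have := integral_std_normal_sqr_affine (M i) 0; rewrite expr0n add0r => <-.
by apply: eq_integral => z _; rewrite tnth_mktuple addr0.
Qed.

End moments.

(** * The divergence between two triangular images of the standard normal law *)

Section trig.
Context {F : fieldType}.

Lemma trig_unitmxP n (A : 'M[F]_n) : is_trig_mx A -> A \in unitmx ->
  forall i, A i i != 0.
Proof.
move=> trigA; rewrite unitmxE unitfE det_trig// => + i.
by apply: contraNN => /eqP Aii; rewrite (bigD1 i)//= Aii mul0r.
Qed.

(** Row i of A A^-1 = 1, to the right of the diagonal, involves only the rows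
of A^-1 up to i, and the rows before i vanish there by induction. *)
Lemma trig_invmx n (A : 'M[F]_n) : is_trig_mx A -> A \in unitmx ->
  is_trig_mx (invmx A).
Proof.
move=> trigA uA; have Aii := trig_unitmxP trigA uA.
apply/is_trig_mxP => i; have [m] := ubnP (val i).
elim: m i => // m IH i; rewrite ltnS => im j ij.
have /matrixP/(_ i j) := mulmxV uA.
rewrite !mxE (bigD1 i)//= big1 ?addr0 => [|k ki].
  have -> : (i == j) = false by apply/negbTE; rewrite neq_ltn ij.
  by move/eqP; rewrite mulf_eq0 (negbTE (Aii i)) => /eqP.
case: (ltngtP k i) => [lki|lik|/val_inj ki']; last by rewrite ki' eqxx in ki.
  by rewrite (IH k (leq_trans lki im) j (ltn_trans lki ij)) mulr0.
by rewrite (is_trig_mxP trigA)// mul0r.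
Qed.

Lemma trig_mulmx n (A B : 'M[F]_n) : is_trig_mx A -> is_trig_mx B ->
  is_trig_mx (A *m B).
Proof.
move=> /is_trig_mxP tA /is_trig_mxP tB; apply/is_trig_mxP => i j ij.
rewrite !mxE big1// => k _.
have [ik|ki] := ltnP i k; first by rewrite tA ?mul0r.
by rewrite tB ?mulr0// (leq_ltn_trans ki).
Qed.

End trig.

Section KLgauss.
Local Open Scope classical_set_scope.
Context {R : realType}.
Local Notation tup n := (n.-tuple (measurableTypeR R)).
Implicit Type n : nat.
Local Open Scope charge_scope.

(** The derivative in the definition of KL is only known Q-almost everywhere;
this suffices, because P is dominated by Q. *)
Lemma KL_density d (T : measurableType d) (P Q : probability T R) (h : T -> R) :
  measurable_fun setT h -> (forall x, 0 < h x) ->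
  (forall A, measurable A -> P A = \int[Q]_(x in A) (h x)%:E)%E ->
  (KL P Q = \int[P]_x (ln (h x))%:E)%E.
Proof.
move=> mh h0 PE.
have PQ : P `<< Q.
  apply/null_content_dominatesP => A mA QA0; rewrite PE//.
  by apply: null_set_integral => //; exact/measurable_funTS/measurable_EFinP.
rewrite /KL asboolT//.
set g := 'd (charge_of_finite_measure P) '/d Q.
have mg : measurable_fun setT g.
  by apply: measurable_int; exact: Radon_Nikodym_integrable.
have gfin x : g x \is a fin_num by exact: Radon_Nikodym_fin_num.
have gh : ae_eq P setT g (EFin \o h).
  apply: (null_dominates_ae_eq _ PQ) => //.
  apply: integral_ae_eq => //.
  - exact: Radon_Nikodym_integrable.
  - exact/measurable_EFinP.
  - by move=> A _ mA; rewrite -Radon_Nikodym_integral//= PE.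
apply: ae_eq_integral => //.
- rewrite (_ : (fun x => lne (g x)) =
    (fun x => if fine (g x) <= 0 then -oo%E else (ln (fine (g x)))%:E)).
    apply: measurable_fun_ifT => //.
      by apply: measurable_fun_ler => //; exact: measurableT_comp.
    apply/measurable_EFinP; apply: measurableT_comp => //.
    exact: measurableT_comp.
  by apply/funext => x; rewrite -{1}(fineK (gfin x)).
- by apply/measurable_EFinP; exact: measurableT_comp.
by apply: filterS gh => x /= + _ => /(_ I) ->; rewrite lne_EFin.
Qed.

Lemma tmulmxM n (A B : 'M[R]_n) (z : tup n) :
  tmulmx A (tmulmx B z) = tmulmx (A *m B) z.
Proof.
apply: eq_from_tnth => i; rewrite !tnth_mktuple.
under eq_bigr do rewrite tnth_mktuple mulr_sumr.
rewrite exchange_big /=; apply: eq_bigr => j _; rewrite mxE mulr_suml.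
by apply: eq_bigr => k _; rewrite mulrA.
Qed.

Lemma tmulmx1 n (z : tup n) : tmulmx 1%:M z = z.
Proof.
apply: eq_from_tnth => i; rewrite tnth_mktuple (bigD1 i)//= mxE eqxx mul1r.
by rewrite big1 ?addr0// => j ji; rewrite mxE eq_sym (negbTE ji) mul0r.
Qed.

(** Density of the law of A Z with respect to that of B Z, where Z is standard
normal and A and B are triangular. *)
Definition gauss_ratio n (A B : 'M[R]_n) (x : tup n) : R :=
  `|\det (invmx A *m B)| *
  expR ((sqnorm (tmulmx (invmx B) x) - sqnorm (tmulmx (invmx A) x)) / 2).

Lemma measurable_gauss_ratio n (A B : 'M[R]_n) :
  measurable_fun setT (gauss_ratio A B).
Proof.
apply: measurable_funM => //; apply: measurableT_comp => //.
apply: measurable_funM => //; apply: measurable_funB.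
  exact: measurableT_comp (@measurable_sqnorm R n) (measurable_tmulmx _).
exact: measurableT_comp (@measurable_sqnorm R n) (measurable_tmulmx _).
Qed.

(** Substitute z -> C z with C = A^-1 B in the integral of f (A z); this turns
A z into B z. *)
Lemma integral_tmulmx_gauss_ratio n (A B : 'M[R]_n) (f : tup n -> \bar R) :
  is_trig_mx A -> is_trig_mx B -> A \in unitmx -> B \in unitmx ->
  measurable_fun setT f -> (forall x, 0 <= f x)%E ->
  (\int[distribution (std_normal n) (tmulmx A)]_x f x =
   \int[distribution (std_normal n) (tmulmx B)]_x
     (f x * (gauss_ratio A B x)%:E))%E.
Proof.
move=> tA tB uA uB mf f0.
have mratio := measurable_gauss_ratio A B.
rewrite ge0_integral_distribution//.
rewrite ge0_integral_distribution//; last 2 first.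
- by apply: emeasurable_funM => //; exact/measurable_EFinP.
- by move=> x; rewrite mule_ge0// lee_fin mulr_ge0// expR_ge0.
pose C := invmx A *m B.
have tC : is_trig_mx C by apply: trig_mulmx tB; exact: trig_invmx.
have uC : C \in unitmx by rewrite unitmx_mul unitmx_inv uA.
have CE z : taff C (fun=> 0) z = tmulmx C z.
  by apply: eq_from_tnth => i; rewrite !tnth_mktuple addr0.
have mfA : measurable_fun setT (f \o tmulmx A).
  exact: measurableT_comp mf (measurable_tmulmx A).
rewrite (@integral_std_normal_affine R n C (fun=> 0) _
  (is_trig_mxP tC) (trig_unitmxP tC uC) mfA (fun=> f0 _)).
apply: eq_integral => z _; rewrite /= CE tmulmxM mulKVmx//.
congr (_ * _%:E)%E.
rewrite /affine_jac /gauss_ratio -det_trig// CE !tmulmxM mulVmx// tmulmx1.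
by [].
Qed.

(** At A z, the logarithm of the density is ln |det (A^-1 B)| plus half of
|B^-1 A z|^2 - |z|^2. *)
Lemma KL_tmulmx n (A B : 'M[R]_n) :
  is_trig_mx A -> is_trig_mx B -> A \in unitmx -> B \in unitmx ->
  (KL (distribution (std_normal n) (tmulmx A))
      (distribution (std_normal n) (tmulmx B)) =
   (ln `|\det (invmx A *m B)| + (sqfro (invmx B *m A) - n%:R) / 2)%:E)%E.
Proof.
move=> tA tB uA uB.
have mratio := measurable_gauss_ratio A B.
have det0 : 0 < `|\det (invmx A *m B)|.
  by rewrite normr_gt0 -unitfE -unitmxE unitmx_mul unitmx_inv uA.
rewrite (@KL_density _ _ _ _ (gauss_ratio A B))//; last 2 first.
- by move=> x; rewrite mulr_gt0// expR_gt0.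
- move=> E mE.
  have m1 : measurable_fun setT (fun x : tup n => (\1_E x)%:E : \bar R).
    exact/measurable_EFinP/measurable_indic.
  transitivity (\int[distribution (std_normal n) (tmulmx A)]_x (\1_E x)%:E)%E.
    by rewrite integral_indic// setIT.
  rewrite (integral_tmulmx_gauss_ratio tA tB uA uB m1); last first.
    by move=> x; rewrite lee_fin.
  rewrite [RHS]integral_mkcond; apply: eq_integral => x _.
  by rewrite patchE indicE; case: ifP => _; rewrite ?mul1e ?mul0e.
have msq (M : 'M[R]_n) :
    measurable_fun setT (fun z : tup n => (sqnorm (tmulmx M z))%:E).
  apply/measurable_EFinP; apply: (measurableT_comp (@measurable_sqnorm R n)).
  exact: measurable_tmulmx.
have int_sq (M : 'M[R]_n) : (std_normal n).-integrable setT
    (fun z => (sqnorm (tmulmx M z))%:E).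
  apply/integrableP; split; first exact: msq.
  have -> : (\int[std_normal n]_z `|(sqnorm (tmulmx M z))%:E| = (sqfro M)%:E)%E.
    rewrite -integral_std_normal_sqnorm; apply: eq_integral => z _.
    by rewrite gee0_abs// lee_fin sumr_ge0// => i _; rewrite sqr_ge0.
  by rewrite ltry.
pose k := ln `|\det (invmx A *m B)|.
pose g (z : tup n) : \bar R := (k%:E + (2^-1)%:E *
  ((sqnorm (tmulmx (invmx B *m A) z))%:E - (sqnorm (tmulmx 1%:M z))%:E))%E.
have int_diff := integrableB measurableT (int_sq (invmx B *m A)) (int_sq 1%:M).
have int_half := integrableZl measurableT 2^-1 int_diff.
have int_k : (std_normal n).-integrable setT (EFin \o cst k).
  exact: finite_measure_integrable_cst.
have int_g : (std_normal n).-integrable setT g by exact: integrableD.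
have gE : (fun x : tup n => (ln (gauss_ratio A B x))%:E) \o tmulmx A = g.
  apply/funext => z /=; rewrite /gauss_ratio !tmulmxM mulVmx//.
  by rewrite lnM ?posrE// ?expR_gt0// expRK EFinD /g EFinM EFinB muleC.
rewrite integral_distribution; last 2 first.
- by apply/measurable_EFinP; exact: measurableT_comp.
- by rewrite gE.
rewrite gE /g integralD//.
rewrite integral_cst//= probability_setT mule1 integralZl//.
rewrite (integralB measurableT (int_sq _) (int_sq _)).
rewrite !integral_std_normal_sqnorm -EFinB -EFinM -EFinD; congr (_ + _)%:E.
rewrite mulrC; congr ((_ - _) / 2); rewrite /sqfro.
transitivity (\sum_(i < n) (1 : R)); last by rewrite sumr_const card_ord.
apply: eq_bigr => i _; rewrite (bigD1 i)//= mxE eqxx expr1n big1 ?addr0//.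
by move=> j ji; rewrite mxE eq_sym (negbTE ji) expr0n.
Qed.

End KLgauss.

(** * Cholesky factors and the objective in closed form *)

Section posdef.
Context {R : realType}.

Lemma sqcolE n (x : 'cV[R]_n) :
  (x^T *m x) 0 0 = \sum_i x i 0 ^+ 2.
Proof. by rewrite mxE; apply: eq_bigr => i _; rewrite mxE expr2. Qed.

Lemma sqcol_gt0 n (x : 'cV[R]_n) : x != 0 -> 0 < (x^T *m x) 0 0.
Proof.
move=> x0; rewrite sqcolE//; have [i xi] : exists i, x i 0 != 0.
  apply: contrapT => /forallNP h; move/eqP: x0; apply; apply/matrixP => i j.
  by rewrite (ord1 j) mxE; apply/eqP/negP => /negP; exact: h.
rewrite (bigD1 i)//= ltr_pwDl// ?lt_def ?sqr_ge0 ?sqrf_eq0 ?xi//.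
by apply: sumr_ge0 => k _; rewrite sqr_ge0.
Qed.

Lemma posdefmx_unit n (T : 'M[R]_n) : posdefmx T -> T \in unitmx.
Proof.
move=> [_ Tpos]; rewrite unitmxE unitfE; apply/det0P => -[v v0 vT].
have := Tpos v^T; rewrite trmxK vT mul0mx mxE ltxx trmx_eq0 => /(_ v0).
by [].
Qed.

Lemma posdefmx_inv_gram n (L : 'M[R]_n) : L \in unitmx ->
  posdefmx (invmx (L *m L^T)).
Proof.
move=> uL; have uLt : L^T \in unitmx by rewrite unitmx_tr.
have -> : invmx (L *m L^T) = (invmx L)^T *m invmx L.
  apply: (@row_full_inj _ _ _ _ (L *m L^T)).
    by rewrite row_full_unit unitmx_mul uL.
  rewrite mulmxV ?unitmx_mul ?uL// -mulmxA trmx_inv.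
  rewrite (mulmxA L^T) mulmxV// mul1mx.
  by rewrite mulmxV.
split; first by rewrite trmx_mul trmxK.
move=> x x0; rewrite mulmxA -mulmxA -trmx_mul; apply: sqcol_gt0.
by apply: contraNneq x0 => h; rewrite -[x](mulKVmx uL) h mulmx0.
Qed.

(** The form of the Schur complement at y is the form of S at y completed by
the first coordinate that makes it minimal. *)
Lemma posdefmx_schur n (S : 'M[R]_(1 + n)) : posdefmx S ->
  0 < S 0 0 /\
  posdefmx (drsubmx S - (S 0 0)^-1 *: (dlsubmx S *m (dlsubmx S)^T)).
Proof.
move=> [symS posS].
have split_quad (x0 : 'cV[R]_1) (y : 'cV[R]_n) :
    (col_mx x0 y)^T *m S *m col_mx x0 y =
    x0^T *m ulsubmx S *m x0 + y^T *m dlsubmx S *m x0 +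
    (x0^T *m (dlsubmx S)^T *m y + y^T *m drsubmx S *m y).
  rewrite tr_col_mx -{1}[S]submxK mul_row_block mul_row_col !mulmxDl.
  by rewrite trmx_dlsub symS.
have ulE : ulsubmx S = (S 0 0)%:M.
  by rewrite [LHS]mx11_scalar !mxE; congr (S _ _)%:M; exact: val_inj.
have a0 : 0 < S 0 0.
  have := posS (col_mx 1%:M 0); rewrite split_quad ulE trmx0 trmx1.
  rewrite !(mulmx0, mul0mx, addr0, mul1mx, mulmx1) mxE eqxx mulr1n; apply.
  by rewrite col_mx_eq0 negb_and oner_neq0.
split => //.
split.
  rewrite linearB linearZ /= trmx_mul trmxK; congr (_ - _).
  by rewrite -{2}symS -trmx_drsub.
move=> y y0; pose x0 := (- (S 0 0)^-1) *: ((dlsubmx S)^T *m y).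
have := posS (col_mx x0 y); rewrite split_quad ulE col_mx_eq0 negb_and y0 orbT.
move=> /(_ isT); congr (0 < fun_of_matrix _ _ _).
have x0T : x0^T = (- (S 0 0)^-1) *: (y^T *m dlsubmx S).
  by rewrite linearZ /= trmx_mul trmxK.
rewrite x0T mul_mx_scalar scalerA mulrN mulfV ?gt_eqF// scaleN1r mulNmx addNr.
rewrite add0r addrC mulmxBr mulmxBl -!scalemxAl -scalemxAr -scalemxAl scaleNr.
by rewrite !mulmxA.
Qed.

(** The first column of the factor is the first column of S divided by the
root of the corner; what remains to be factored is the Schur complement. *)
Lemma cholesky n (S : 'M[R]_n) : posdefmx S ->
  exists A : 'M[R]_n, is_trig_mx A /\ A *m A^T = S.
Proof.
elim: n S => [|n IH] S pS.
  by exists 0; split; [exact: mx0_is_trig|rewrite [LHS]flatmx0 [RHS]flatmx0].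
move: S pS; rewrite -[n.+1]/(1 + n)%N => S pS.
have [a0 /IH[A [tA AE]]] := posdefmx_schur pS.
have sa0 : 0 < Num.sqrt (S 0 0) by rewrite sqrtr_gt0.
have sa2 : Num.sqrt (S 0 0) * Num.sqrt (S 0 0) = S 0 0.
  by rewrite -expr2 sqr_sqrtr// ltW.
exists (block_mx (Num.sqrt (S 0 0))%:M 0
          ((Num.sqrt (S 0 0))^-1 *: dlsubmx S) A); split.
  by rewrite is_trig_block_mx// eqxx tA scalar_mx_is_trig.
rewrite tr_block_mx mulmx_block -[RHS]submxK !trmx0 !(mulmx0, mul0mx, addr0).
have ulE : ulsubmx S = (S 0 0)%:M.
  by rewrite [LHS]mx11_scalar !mxE; congr (S _ _)%:M; exact: val_inj.
have urE : ursubmx S = (dlsubmx S)^T by rewrite trmx_dlsub (proj1 pS).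
rewrite tr_scalar_mx linearZ /= -scalar_mxM sa2 ulE urE AE.
rewrite mul_scalar_mx mul_mx_scalar !scalerA mulfV ?gt_eqF// scale1r.
rewrite -scalemxAl -scalemxAr scalerA -invfM sa2.
by rewrite scale1r [X in block_mx _ _ _ X]addrC subrK.
Qed.

(** The definition of gaussian falls back on the factor 0 if there is no
triangular one; a Cholesky factor exists, so this does not happen. *)
Lemma gaussianE n (S : 'M[R]_n) : posdefmx S ->
  exists A : 'M[R]_n, [/\ is_trig_mx A, A *m A^T = S, A \in unitmx &
    gaussian S = distribution (std_normal n) (tmulmx A)].
Proof.
move=> pS; rewrite /gaussian.
have [tA AE] := xgetPex 0 (cholesky pS).
eexists; split; [exact: tA|exact: AE| |by []].
by have := posdefmx_unit pS; rewrite -{1}AE unitmx_mul => /andP[].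
Qed.

Lemma sqfro_tr n (M : 'M[R]_n) : sqfro M = \tr (M *m M^T).
Proof.
rewrite /sqfro /mxtrace; apply: eq_bigr => i _; rewrite mxE.
by apply: eq_bigr => j _; rewrite mxE expr2.
Qed.

Lemma norm_det_gram n (A : 'M[R]_n) : `|\det A| = Num.sqrt (\det (A *m A^T)).
Proof. by rewrite det_mulmx det_tr -expr2 sqrtr_sqr. Qed.

(** Let A A^T = Theta and B B^T = (L L^T)^-1. The divergence depends on A and
B only through these products: |B^-1 A|^2 is the trace of Theta (B B^T)^-1,
and |det A| and |det B| are roots of determinants. *)
Lemma KLobjE n (Theta L : 'M[R]_n) : posdefmx Theta -> L \in unitmx ->
  KLobj Theta L = ((\tr (L^T *m Theta *m L) - n%:R) / 2 - ln `|\det L|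
    - ln (Num.sqrt (\det Theta)))%:E.
Proof.
move=> pT uL; rewrite /KLobj.
have [A [tA AE uA ->]] := gaussianE pT.
have [B [tB BE uB ->]] := gaussianE (posdefmx_inv_gram uL).
have uG : L *m L^T \in unitmx by rewrite unitmx_mul unitmx_tr uL.
have dpos (M : 'M[R]_n) : M \in unitmx -> 0 < `|\det M|.
  by rewrite unitmxE unitfE normr_gt0.
rewrite KL_tmulmx//; congr EFin.
have -> : sqfro (invmx B *m A) = \tr (L^T *m Theta *m L).
  rewrite sqfro_tr trmx_mul mulmxA -(mulmxA (invmx B)) AE.
  rewrite mxtrace_mulC mulmxA.
  have -> : (invmx B)^T *m invmx B = L *m L^T.
    have BV : (invmx B)^T *m invmx B *m (B *m B^T) = 1%:M.
      by rewrite mulmxA mulmxKV// -trmx_mul mulmxV// trmx1.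
    by rewrite -[LHS](mulmxKV uG) -BE BV mul1mx.
  by rewrite -(mulmxA L) [LHS]mxtrace_mulC.
have -> : ln `|\det (invmx A *m B)| =
    - ln (Num.sqrt (\det Theta)) - ln `|\det L|.
  rewrite det_mulmx det_inv normrM normfV lnM ?posrE ?invr_gt0 ?dpos//.
  rewrite lnV ?posrE ?dpos// -AE -norm_det_gram; congr (_ + _).
  rewrite (norm_det_gram B) BE det_inv det_mulmx det_tr -expr2 -exprVn.
  rewrite sqrtr_sqr.
  by rewrite normfV lnV ?posrE ?dpos.
by rewrite addrC addrA addrAC.
Qed.

End posdef.

(** * The minimization of one column *)

Section onecol.
Context {R : realType}.

Lemma subr_ln_ge1 (t : R) : 0 < t -> 1 <= t - ln t ?= iff (t == 1).
Proof.
move=> t0; have [->|t1] := eqVneq t 1; first by apply/leifP; rewrite ln1 subr0.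
apply/leifP; have lt0 : ln t != 0 by rewrite ln_eq0// .
have := expR_gt1Dx lt0; rewrite lnK ?posrE// => h; lra.
Qed.

(** The entry of l paired with e1 is the diagonal entry of the factor, whose
logarithm is the contribution of this column to ln |det L|. *)
Definition colcost m (T : 'M[R]_m) (l : 'cV[R]_m) : R :=
  (l^T *m T *m l) 0 0 / 2 - ln `|((e1 m)^T *m l) 0 0|.

(** When T is the restriction of Theta to s_i, this is convertible to KLcol.
*)
Definition optcol m (T : 'M[R]_m) : 'cV[R]_m :=
  (Num.sqrt (((e1 _)^T *m invmx T *m e1 _) 0 0))^-1 *: (invmx T *m e1 _).

Lemma e1_mulmx m (v : 'cV[R]_m) (m0 : (0 < m)%N) :
  ((e1 m)^T *m v) 0 0 = v (Ordinal m0) 0.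
Proof.
rewrite mxE (bigD1 (Ordinal m0))//= !mxE mul1r big1 ?addr0// => k kk.
rewrite !mxE (_ : (val k == 0%N) = false) ?mul0r//.
by apply: contraNF kk => /eqP k0; apply/eqP/val_inj.
Qed.

Lemma e1_neq0 m : (0 < m)%N -> e1 m != 0 :> 'cV[R]_m.
Proof.
move=> m0; apply/eqP => /matrixP/(_ (Ordinal m0) 0); rewrite !mxE eqxx.
by move/eqP; rewrite oner_eq0.
Qed.

Lemma posdefmx_inv n (T : 'M[R]_n) : posdefmx T -> posdefmx (invmx T).
Proof.
move=> pT; have uT := posdefmx_unit pT; case: pT => symT posT.
have symI : (invmx T)^T = invmx T by rewrite trmx_inv symT.
split=> // x x0; rewrite -{1}symI -trmx_mul.
have := posT (invmx T *m x); rewrite -mulmxA mulKVmx//; apply.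
by apply: contraNneq x0 => h; rewrite -[x](mulKVmx uT) h mulmx0.
Qed.

Lemma invmx_e1_gt0 m (T : 'M[R]_m) : (0 < m)%N -> posdefmx T ->
  0 < ((e1 _)^T *m invmx T *m e1 _) 0 0.
Proof. by move=> m0 /posdefmx_inv[_]; apply; exact: e1_neq0. Qed.

Lemma e1_optcol m (T : 'M[R]_m) : (0 < m)%N -> posdefmx T ->
  ((e1 _)^T *m optcol T) 0 0 =
  Num.sqrt (((e1 _)^T *m invmx T *m e1 _) 0 0).
Proof.
move=> m0 pT; have a0 := invmx_e1_gt0 m0 pT.
rewrite /optcol; set a := ((e1 _)^T *m _ *m _) 0 0 in a0 *.
rewrite -scalemxAr mxE mulmxA -/a.
by rewrite -{2}(sqr_sqrtr (ltW a0)) expr2 mulKf// gt_eqF// sqrtr_gt0.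
Qed.

(** With u = T^-1 e1, a = e1^T u and y the first entry of l, the vector d = l
- (y / a) u is T-orthogonal to u, and the cost becomes d^T T d / 2 + (t - ln
t) / 2 - (ln a) / 2 for t = y^2 / a. It is minimal when d = 0 and t = 1. *)
Lemma colcost_min m (T : 'M[R]_m) (l : 'cV[R]_m) : (0 < m)%N -> posdefmx T ->
  ((e1 _)^T *m l) 0 0 != 0 ->
  colcost T (optcol T) <= colcost T l ?= iff
    (l == (-1) ^+ (((e1 _)^T *m l) 0 0 < 0)%R *: optcol T).
Proof.
move=> m0 pT; set y := ((e1 _)^T *m l) 0 0 => y0.
have uT := posdefmx_unit pT; have a0 := invmx_e1_gt0 m0 pT.
case: (pT) => symT posT.
have := e1_optcol m0 pT.
pose a := ((e1 _)^T *m invmx T *m e1 _) 0 0 : R; rewrite -/a in a0 *.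
pose u := invmx T *m e1 m : 'cV[R]_m.
have Tu : T *m u = e1 m by rewrite mulKVmx.
have uTT : u^T *m T = (e1 m)^T by rewrite -{1}symT -trmx_mul Tu.
have optE : optcol T = (Num.sqrt a)^-1 *: u by [].
have e1u : (e1 m)^T *m u = a%:M by rewrite mulmxA [LHS]mx11_scalar.
have sa0 : 0 < Num.sqrt a by rewrite sqrtr_gt0.
have sa2 : Num.sqrt a ^+ 2 = a by rewrite sqr_sqrtr// ltW.
move=> e1opt.
have trZ c (x : 'cV[R]_m) : (c *: x)^T = c *: x^T by rewrite linearZ.
have optcost : colcost T (optcol T) = 2^-1 - ln (Num.sqrt a).
  have q1 : (optcol T)^T *m T *m optcol T = 1%:M.
    rewrite optE trZ -!scalemxAl uTT -scalemxAr e1u scalerA.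
    by rewrite scale_scalar_mx -invfM -expr2 sa2 mulVf ?gt_eqF.
  by rewrite /colcost e1opt gtr0_norm// q1 mxE eqxx mul1r.
pose k := y / a.
have [d dE] : exists d, d = l - k *: u by exists (l - k *: u).
have e1l : (e1 m)^T *m l = y%:M by rewrite [LHS]mx11_scalar.
have e1d : (e1 m)^T *m d = 0.
  rewrite dE mulmxBr -scalemxAr e1u e1l scale_scalar_mx /k divfK ?gt_eqF//.
  exact: subrr.
have dTu : d^T *m T *m u = 0.
  by rewrite -mulmxA Tu -[e1 m]trmxK -trmx_mul e1d trmx0.
have lE : l = d + k *: u by rewrite dE subrK.
have lT : l^T = d^T + k *: u^T by rewrite -trZ -[RHS]linearD /= -lE.
have lcost : (l^T *m T *m l) 0 0 = (d^T *m T *m d) 0 0 + y ^+ 2 / a.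
  rewrite lT {1}lE !mulmxDl !mulmxDr -!scalemxAl -!scalemxAr.
  rewrite uTT dTu e1d e1u !scaler0 addr0 add0r !mxE eqxx mulr1n.
  by congr (_ + _); rewrite /k; field; rewrite gt_eqF.
pose t := y ^+ 2 / a.
have t0 : 0 < t by rewrite divr_gt0// exprn_even_gt0.
have lny : ln `|y| = ln t / 2 + ln (Num.sqrt a).
  rewrite /t -real_normK ?num_real// -[in ln (_ / a)]sa2.
  rewrite ln_div ?posrE ?exprn_gt0 ?normr_gt0//.
  have n0 : 0 < `|y| by rewrite normr_gt0.
  by rewrite (lnXn 2 sa0) (lnXn 2 n0) !mulr2n; field.
rewrite optcost /colcost -/y lcost lny -/t.
have d_ge0 : 0 <= (d^T *m T *m d) 0 0 ?= iff (d == 0).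
  have [->|d0] := eqVneq d 0; apply/leifP; first by rewrite mulmx0 mxE.
  exact: posT.
have tln := subr_ln_ge1 t0.
have -> : (l == (-1) ^+ (y < 0)%R *: optcol T) = (d == 0) && (t == 1).
  set e := (-1) ^+ (y < 0)%R.
  have e2 : e ^+ 2 = 1 by rewrite sqrr_sign.
  have kE : y = e * Num.sqrt a -> k = e / Num.sqrt a.
    by move=> yE; rewrite /k yE -{2}sa2; field; rewrite gt_eqF.
  apply/eqP/andP => [lopt|[/eqP d0 /eqP t1]].
    have yE : y = e * Num.sqrt a.
      by rewrite /y [in LHS]lopt -scalemxAr mxE e1opt.
    rewrite /t yE exprMn e2 mul1r sa2 divff ?(lt0r_neq0 a0)// eqxx; split=> //.
    by rewrite dE kE// [X in X - _]lopt optE scalerA subrr.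
  have yE : y = e * Num.sqrt a.
    rewrite [LHS]realEsign ?num_real// -/e; congr (_ * _).
    rewrite -sqrtr_sqr; congr Num.sqrt.
    by rewrite -[LHS](divfK (lt0r_neq0 a0)) -/t t1 mul1r.
  by rewrite {1}lE d0 add0r kE// optE scalerA.
have := leifD d_ge0 tln; rewrite add0r => -[h1 h2].
split; first by lra.
rewrite -h2; apply/eqP/eqP => ?; lra.
Qed.

End onecol.

(** * Minimizers of the objective *)

Section argmin.
Context {R : realType}.
Variable N : nat.
Implicit Types (Theta L : 'M[R]_N) (S : {set 'I_N * 'I_N}) (s : {set 'I_N}).

(** Extension by zero; the sum has at most one term because enum_val is
injective. *)
Definition extcol s (x : 'cV[R]_#|s|) : 'cV[R]_N :=
  \col_j \sum_(k | enum_val k == j) x k 0.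

Lemma extcol_in s (x : 'cV[R]_#|s|) k : extcol x (enum_val k) 0 = x k 0.
Proof.
rewrite mxE (eq_bigl (xpred1 k)) ?big_pred1_eq// => k'.
by rewrite (inj_eq enum_val_inj).
Qed.

Lemma extcol_notin s (x : 'cV[R]_#|s|) j : j \notin s -> extcol x j 0 = 0.
Proof.
move=> js; rewrite mxE big_pred0// => k; apply: contraNF js => /eqP <-.
exact: enum_valP.
Qed.

Lemma quad_submx Theta s (v : 'cV[R]_N) : (forall j, j \notin s -> v j 0 = 0) ->
  (v^T *m Theta *m v) 0 0 =
  ((\col_k v (enum_val k) 0)^T *m submx_set Theta s *m
    (\col_(k < #|s|) v (enum_val k) 0)) 0 0.
Proof.
move=> v0; have restrict (F : 'I_N -> R) : (forall j, j \notin s -> F j = 0) ->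
    \sum_j F j = \sum_(k < #|s|) F (enum_val k).
  move=> F0; rewrite -(big_enum_val (A := mem s) F)/= [LHS](bigID (mem s))/=.
  by rewrite [X in _ + X]big1 ?addr0.
rewrite !mxE restrict => [|j /v0 ->]; last by rewrite mulr0.
apply: eq_bigr => k _; rewrite !mxE; congr (_ * _).
rewrite restrict => [|j /v0]; last by rewrite mxE => ->; rewrite mul0r.
by apply: eq_bigr => k' _; rewrite !mxE.
Qed.

Lemma posdefmx_submx Theta s : posdefmx Theta -> posdefmx (submx_set Theta s).
Proof.
move=> [symT posT]; split; first by rewrite trmx_mxsub symT.
move=> x x0; have xE : x = \col_k extcol x (enum_val k) 0.
  by apply/matrixP => k j; rewrite (ord1 j) mxE extcol_in.
rewrite xE -quad_submx; last exact: extcol_notin.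
apply: posT; apply: contraNneq x0 => h; rewrite xE h.
by apply/eqP/matrixP => k j; rewrite !mxE.
Qed.

(** In a lower triangular pattern, i is the least element of s_i, and enum_val
is increasing. *)
Lemma enum_val_scol S i (k : 'I_#|scol S i|) : lower_sparsity S ->
  (enum_val k == i) = (val k == 0%N).
Proof.
move=> [lowS diagS]; have iS : i \in scol S i by rewrite inE.
have lt_enum (k1 k2 : 'I_#|scol S i|) : (k1 < k2)%N ->
    ((enum_val k1 : 'I_N) < (enum_val k2 : 'I_N))%N.
  move=> k12; rewrite !(enum_val_nth i).
  have sorted_s : sorted (relpre val ltn) (enum (scol S i)).
    apply: (@sorted_filter _ (relpre val ltn)).
      by move=> ? ? ?; exact: ltn_trans.
    by rewrite -sorted_map -enumT val_enum_ord iota_ltn_sorted.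
  apply: (sorted_ltn_nth _ _ sorted_s) => //.
    by move=> ? ? ?; exact: ltn_trans.
    by rewrite inE -cardE.
  by rewrite inE -cardE.
have ge_i (k1 : 'I_#|scol S i|) : (i <= (enum_val k1 : 'I_N))%N.
  by have := enum_valP k1; rewrite inE => /lowS.
pose k0 := enum_rank_in iS i.
have k0E : enum_val k0 = i by rewrite enum_rankK_in.
have k00 : val k0 = 0%N.
  apply/eqP; rewrite -leqn0 leqNgt; apply/negP => k0_gt0.
  have m0 : (0 < #|scol S i|)%N by exact: leq_ltn_trans (ltn_ord k0).
  have := @lt_enum (Ordinal m0) k0 k0_gt0; rewrite k0E ltnNge ge_i.
  by [].
by rewrite -{2}k0E (inj_eq enum_val_inj) -k00.
Qed.

Lemma scol_gt0 S i : lower_sparsity S -> (0 < #|scol S i|)%N.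
Proof. by move=> [_ dS]; apply/card_gt0P; exists i; rewrite inE. Qed.

Lemma e1_subcol L S i : lower_sparsity S ->
  ((e1 _)^T *m subcol L (scol S i) i) 0 0 = L i i.
Proof.
move=> lS; rewrite (e1_mulmx _ (scol_gt0 i lS)) mxE.
by congr (L _ _); apply/eqP; rewrite enum_val_scol.
Qed.

Lemma sparse_det L S : lower_sparsity S -> sparse S L ->
  \det L = \prod_i L i i.
Proof.
move=> [lS _] sL; apply: det_trig; apply/is_trig_mxP => i j ij.
apply/eqP; apply: contraTT ij => /sL/lS ji; by rewrite -leqNgt.
Qed.

Lemma sparse_unitmx L S : lower_sparsity S -> sparse S L ->
  (L \in unitmx) = [forall i, L i i != 0].
Proof.
move=> lS sL; rewrite unitmxE unitfE (sparse_det lS sL).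
by apply/prodf_neq0/forallP => h i *; exact: h.
Qed.

Lemma subcol_inj L L' S : sparse S L -> sparse S L' ->
  (forall i, subcol L (scol S i) i = subcol L' (scol S i) i) -> L = L'.
Proof.
move=> sL sL' LL'; apply/matrixP => j i.
have [ji|ji] := boolP ((j, i) \in S); last first.
  transitivity (0 : R); first by apply/eqP; apply: contraNT ji => /sL.
  by apply/esym/eqP; apply: contraNT ji => /sL'.
have js : j \in scol S i by rewrite inE.
have /matrixP/(_ (enum_rank_in js j) 0) := LL' i.
by rewrite !mxE enum_rankK_in.
Qed.

(** The trace is a sum over the columns of L, each of which is supported in
s_i, and the determinant of the lower triangular L is the product of its
diagonal entries. *)
Lemma KLobj_colcost Theta S L : posdefmx Theta -> lower_sparsity S ->
  sparse S L -> L \in unitmx ->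
  KLobj Theta L =
  (\sum_i colcost (submx_set Theta (scol S i)) (subcol L (scol S i) i)
   - (N%:R / 2 + ln (Num.sqrt (\det Theta))))%:E.
Proof.
move=> pT lS sL uL; rewrite KLobjE//; congr EFin.
have L0 i : L i i != 0 by move: uL; rewrite (sparse_unitmx lS sL) => /forallP.
rewrite /colcost sumrB -mulr_suml.
have -> : \sum_i ((subcol L (scol S i) i)^T *m submx_set Theta (scol S i) *m
    subcol L (scol S i) i) 0 0 = \tr (L^T *m Theta *m L).
  apply: eq_bigr => i _.
  transitivity (((col i L)^T *m Theta *m col i L) 0 0).
    rewrite (@quad_submx _ (scol S i)) => [|j]; last first.
      by rewrite inE mxE => ji; apply/eqP; apply: contraNT ji => /sL.
    by congr ((_^T *m _ *m _) 0 0); apply/matrixP => k j; rewrite !mxE.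
  by rewrite tr_col -row_mul !mxE; apply: eq_bigr => j _; rewrite !mxE.
have -> : \sum_i ln `|((e1 _)^T *m subcol L (scol S i) i) 0 0| = ln `|\det L|.
  under eq_bigr do rewrite e1_subcol//.
  rewrite (sparse_det lS sL) normr_prod.
  suff [] : 0 < \prod_i `|L i i| /\
      \sum_i ln `|L i i| = ln (\prod_i `|L i i|) by [].
  elim/big_rec2: _ => [|i p y _ [p0 ->]]; first by rewrite ln1.
  have Li : 0 < `|L i i| by rewrite normr_gt0.
  by rewrite mulr_gt0// lnM.
rewrite mulrBl; ring.
Qed.

Definition optmx Theta S : 'M[R]_N :=
  \matrix_(j, i) extcol (KLcol Theta S i) j 0.

Lemma optmx_sparse Theta S : sparse S (optmx Theta S).
Proof.
move=> i j; rewrite mxE; apply: contraNT => ij; apply/eqP/extcol_notin.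
by rewrite inE.
Qed.

Lemma subcol_optmx Theta S i :
  subcol (optmx Theta S) (scol S i) i = KLcol Theta S i.
Proof. by apply/matrixP => k j; rewrite (ord1 j) !(mxE, extcol_in). Qed.

Lemma optmx_diag_gt0 Theta S i : posdefmx Theta -> lower_sparsity S ->
  0 < optmx Theta S i i.
Proof.
move=> pT lS; rewrite -(e1_subcol _ _ lS) subcol_optmx.
have pTi := posdefmx_submx (scol S i) pT.
rewrite e1_optcol ?scol_gt0//.
by rewrite sqrtr_gt0; apply: invmx_e1_gt0 => //; exact: scol_gt0.
Qed.

(** Every column of a factor costs at least as much as the column of optmx, so
a minimizer must reach this bound in every column. The cost of a column does
not see its sign, which is that of the diagonal entry. *)
Lemma KLargminP Theta S L : posdefmx Theta -> lower_sparsity S ->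
  KLargmin Theta S L <->
  sparse S L /\
  forall i, subcol L (scol S i) i = (-1) ^+ (L i i < 0)%R *: KLcol Theta S i.
Proof.
move=> pT lS.
have pTi i := posdefmx_submx (scol S i) pT.
have su_opt : optmx Theta S \in unitmx.
  rewrite (sparse_unitmx lS (@optmx_sparse _ _)); apply/forallP => i.
  by rewrite gt_eqF// optmx_diag_gt0.
have min_i L' i : sparse S L' -> L' \in unitmx ->
    colcost (submx_set Theta (scol S i)) (KLcol Theta S i) <=
    colcost (submx_set Theta (scol S i)) (subcol L' (scol S i) i)
    ?= iff (subcol L' (scol S i) i ==
            (-1) ^+ (L' i i < 0)%R *: KLcol Theta S i).
  move=> sL' uL'; rewrite -(e1_subcol L' i lS).
  apply: colcost_min; [exact: scol_gt0|exact: pTi|].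
  by rewrite e1_subcol//; move: uL'; rewrite (sparse_unitmx lS sL') => /forallP.
have KLopt : KLobj Theta (optmx Theta S) =
    (\sum_i colcost (submx_set Theta (scol S i)) (KLcol Theta S i)
     - (N%:R / 2 + ln (Num.sqrt (\det Theta))))%:E.
  rewrite (KLobj_colcost pT lS (@optmx_sparse _ _) su_opt).
  by under eq_bigr do rewrite subcol_optmx.
have min_sum L' : sparse S L' -> L' \in unitmx ->
    (KLobj Theta (optmx Theta S) <= KLobj Theta L')%E.
  move=> sL' uL'; rewrite KLopt (KLobj_colcost pT lS sL' uL') lee_fin lerD2r.
  by apply: ler_sum => i _; case: (min_i _ i sL' uL').
split=> [[sL uL minL]|[sL Lcol]].
  split=> // i; apply/eqP.
  have := minL _ (@optmx_sparse Theta S) su_opt.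
  rewrite KLopt (KLobj_colcost pT lS sL uL) lee_fin lerD2r => le_sum.
  have := leif_sum (fun i (_ : true) => min_i _ i sL uL).
  by move=> /ge_leif; rewrite le_sum => /esym/forallP/(_ i).
have uL : L \in unitmx.
  rewrite (sparse_unitmx lS sL); apply/forallP => i.
  rewrite -(e1_subcol _ _ lS) Lcol -scalemxAr mxE mulf_neq0 ?signr_eq0//.
  rewrite -(subcol_optmx Theta) e1_subcol//.
  by rewrite gt_eqF// optmx_diag_gt0.
split; [by []|by []|move=> L' sL' uL'].
suff h : (KLobj Theta L <= KLobj Theta (optmx Theta S))%E.
  exact: (le_trans h (min_sum L' sL' uL')).
rewrite KLopt (KLobj_colcost pT lS sL uL) lee_fin lerD2r.
apply: ler_sum => i _; have [_] := min_i _ i sL uL.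
by rewrite Lcol eqxx => /eqP ->.
Qed.

End argmin.

Section part1.
Context {R : realType} (N : nat) (Theta : 'M[R]_N) (S : {set 'I_N * 'I_N}).
Hypotheses (pT : posdefmx Theta) (lS : lower_sparsity S).
Implicit Types L : 'M[R]_N.

Lemma optmx_KLargmin : KLargmin Theta S (optmx Theta S).
Proof.
apply/(KLargminP _ pT lS); split; first exact: optmx_sparse.
move=> i; rewrite subcol_optmx ltNge ltW ?optmx_diag_gt0//.
by rewrite expr0 scale1r.
Qed.

Lemma KLargmin_subcol L : KLargmin Theta S L -> (forall i, 0 < L i i) ->
  forall i, subcol L (scol S i) i = KLcol Theta S i.
Proof.
move=> /(KLargminP _ pT lS)[_ Lcol] Lpos i.
by rewrite Lcol ltNge ltW ?Lpos// expr0 scale1r.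
Qed.

Lemma sign_diagE (L : 'M[R]_N) (s : 'I_N -> bool) j i :
  (L *m diag_mx (\row_k (-1) ^+ s k)) j i = (-1) ^+ s i * L j i.
Proof. by rewrite mul_mx_diag !mxE mulrC. Qed.

Lemma sparse_sign L (s : 'I_N -> bool) : sparse S L ->
  sparse S (L *m diag_mx (\row_k (-1) ^+ s k)).
Proof.
move=> sL j i; rewrite sign_diagE => h; apply: sL.
by apply: contraNneq h => ->; rewrite mulr0.
Qed.

Lemma subcol_sign L (s : 'I_N -> bool) i :
  subcol (L *m diag_mx (\row_k (-1) ^+ s k)) (scol S i) i =
  (-1) ^+ s i *: subcol L (scol S i) i.
Proof. by apply/matrixP => k j; rewrite mxE sign_diagE !mxE. Qed.

Lemma KLargmin_signs L L' : KLargmin Theta S L ->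
  (KLargmin Theta S L' <->
   exists s : 'I_N -> bool, L' = L *m diag_mx (\row_i (-1) ^+ s i)).
Proof.
move=> minL; have [_ uL _] := minL.
move: minL => /(KLargminP _ pT lS)[sL Lcol].
have L0 i : L i i != 0 by move: uL; rewrite (sparse_unitmx lS sL) => /forallP.
split=> [/(KLargminP _ pT lS)[sL' Lcol']|[s ->]].
  pose s i := (L i i < 0)%R (+) (L' i i < 0)%R; exists s.
  apply: (subcol_inj sL' (@sparse_sign L s sL)) => i.
  rewrite subcol_sign Lcol Lcol'; move: (KLcol _ _ _) => v.
  rewrite scalerA -signr_addb.
  by congr ((-1) ^+ _ *: _); rewrite addbAC addbb.
apply/(KLargminP _ pT lS); split; first exact: sparse_sign.
move=> i; rewrite subcol_sign Lcol sign_diagE; move: (KLcol _ _ _) => v.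
rewrite scalerA -signr_addb.
congr ((-1) ^+ _ *: _); case: (s i); last by rewrite expr0 mul1r.
by rewrite expr1 mulN1r oppr_lt0 lt0r L0 /= ltNge negbK.
Qed.

End part1.

(** * Gauss-Jordan elimination without pivoting *)

Section gauss_jordan.
Context {R : realType}.
Variable n : nat.
Implicit Types (M : nat -> nat -> R) (u x : nat -> R).

(** A Gauss-Jordan step on an augmented matrix with right-hand side in column
n. The columns up to the pivot k are left as they are, although they now stand
for columns of the identity. Row n is not part of the system: it receives a
copy of the normalized pivot row. *)
Definition gj_step M k : nat -> nat -> R := fun r c =>
  if (k < c)%N then
    if (r == n) || (r == k) then M k c / M k k
    else M r c - M r k * (M k c / M k k)
  else M r c.

Definition trailing_form M k x : R :=
  \sum_(k <= r < n) \sum_(k <= c < n) x r * M r c * x c.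

(** The first clause says that u solves the system in which the columns before
k are replaced by columns of the identity; the other two say that the block
with rows and columns from k on is symmetric positive definite. *)
Definition gj_inv u M k : Prop :=
  [/\ forall r, (r < n)%N ->
        (if (r < k)%N then u r else 0) + \sum_(k <= c < n) M r c * u c = M r n,
      forall r c, (k <= r < n)%N -> (k <= c < n)%N -> M r c = M c r
    & forall x, (exists2 c, (k <= c < n)%N & x c != 0) ->
        0 < trailing_form M k x].

Lemma trailing_form_split M k x : (k < n)%N ->
  (forall c, (k < c < n)%N -> M c k = M k c) ->
  trailing_form M k x =
  M k k * x k ^+ 2 + 2 * x k * (\sum_(k.+1 <= c < n) M k c * x c)
    + trailing_form M k.+1 x.
Proof.
move=> kn symM; rewrite /trailing_form big_ltn//= big_ltn//=.
under [X in _ + X = _]eq_big_nat => r rk do rewrite big_ltn//=.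
rewrite big_split /= addrA; congr (_ + _).
rewrite -!addrA; congr (_ + _); first by ring.
rewrite mulr_sumr -big_split /=; apply: eq_big_nat => c ck.
by rewrite symM//; ring.
Qed.

Lemma gj_inv_pivot u M k : (k < n)%N -> gj_inv u M k -> 0 < M k k.
Proof.
move=> kn [_ symM posM].
have := posM (fun c => (c == k)%:R); rewrite trailing_form_split//; last first.
  by move=> c /andP[kc cn]; apply: symM; rewrite ?cn ?kn ?leqnn// ltnW.
rewrite eqxx big_nat big1 => [|c /andP[kc _]]; last first.
  by rewrite gtn_eqF// mulr0.
rewrite /trailing_form big_nat big1 => [|r /andP[kr _]]; last first.
  by rewrite big1// => c _; rewrite gtn_eqF// !mul0r.
rewrite mulr0 !addr0 expr1n mulr1; apply; exists k; first by rewrite leqnn.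
by rewrite eqxx oner_neq0.
Qed.

(** Row operations preserve the solution. The new trailing block is the Schur
complement of the pivot: its form at x is the old form at x completed by the
coordinate k that makes it minimal, hence positive. *)
Lemma gj_inv_step u M k : (k < n)%N ->
  gj_inv u M k -> gj_inv u (gj_step M k) k.+1.
Proof.
move=> kn inv; have p_gt0 := gj_inv_pivot kn inv; have p0 := lt0r_neq0 p_gt0.
case: inv => solM symM posM.
pose s r := \sum_(k.+1 <= c < n) M r c * u c.
have sE r : (r < n)%N ->
    (if (r < k)%N then u r else 0) + (M r k * u k + s r) = M r n.
  by move=> /solM; rewrite big_ltn.
split.
- move=> r rn; rewrite {2}/gj_step kn (ltn_eqF rn)/=.
  have sum_step : \sum_(k.+1 <= c < n) gj_step M k r c * u c =
      if r == k then s k / M k k else s r - M r k / M k k * s k.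
    case: ifP => rk.
      rewrite mulr_suml; apply: eq_big_nat => c /andP[kc cn].
      by rewrite /gj_step kc rk orbT; ring.
    rewrite mulr_sumr -sumrB; apply: eq_big_nat => c /andP[kc cn].
    by rewrite /gj_step kc rk (ltn_eqF rn)/=; ring.
  rewrite sum_step; have := sE _ kn; rewrite ltnn add0r => sk.
  have skE : s k = M k n - M k k * u k by rewrite -sk addrC addKr.
  case: (ltngtP r k) => rk.
  + have := sE _ rn; rewrite rk (leqW rk) => <-.
    by rewrite skE; field.
  + have := sE _ rn.
    rewrite ltnNge (ltnW rk)/= [(r < k.+1)%N]ltnS leqNgt rk /= => <-.
    by rewrite skE; field.
  + by rewrite rk ltnSn skE; field.
- move=> r c /andP[kr rn] /andP[kc cn]; rewrite /gj_step kr kc.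
  rewrite !(gtn_eqF kr) !(gtn_eqF kc) (ltn_eqF rn) (ltn_eqF cn)/=.
  have kr' : (k <= r < n)%N by rewrite rn ltnW.
  have kc' : (k <= c < n)%N by rewrite cn ltnW.
  have kk' : (k <= k < n)%N by rewrite kn leqnn.
  by rewrite (symM r c kr' kc') (symM r k kr' kk') (symM k c kk' kc'); field.
- move=> x [c0 /andP[kc0 c0n] xc0].
  pose m := \sum_(k.+1 <= c < n) M k c * x c.
  (* the completion of x that minimizes the form *)
  pose y c := if c == k then - m / M k k else x c.
  have yE c : (k < c)%N -> y c = x c by move=> kc; rewrite /y gtn_eqF.
  have symk c : (k < c < n)%N -> M c k = M k c.
    by move=> /andP[kc cn]; apply: symM; rewrite ?cn ?kn ?leqnn// ltnW.
  have -> : trailing_form (gj_step M k) k.+1 x = trailing_form M k y.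
    rewrite (trailing_form_split y kn symk).
    rewrite (_ : \sum_(k.+1 <= c < n) M k c * y c = m);
      last first.
      by apply: eq_big_nat => c /andP[kc _]; rewrite yE.
    rewrite (_ : trailing_form M k.+1 y = trailing_form M k.+1 x); last first.
      apply: eq_big_nat => r /andP[kr _]; apply: eq_big_nat => c /andP[kc _].
      by rewrite !yE.
    have -> : trailing_form (gj_step M k) k.+1 x =
        trailing_form M k.+1 x - m ^+ 2 / M k k.
      transitivity (trailing_form M k.+1 x -
          \sum_(k.+1 <= r < n) M k r * x r * (m / M k k));
        last by rewrite -mulr_suml -/m; field.
      rewrite /trailing_form -sumrB; apply: eq_big_nat => r /andP[kr rn].
      rewrite /m mulr_suml mulr_sumr -sumrB.
      apply: eq_big_nat => c /andP[kc cn].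
      have rk : (k < r < n)%N by rewrite kr.
      by rewrite /gj_step kc (ltn_eqF rn) (gtn_eqF kr)/= symk//; field.
    by rewrite /y eqxx; field.
  apply: posM; exists c0; first by rewrite c0n ltnW.
  by rewrite yE.
Qed.

Definition gj_run M k := iteri k (fun j M' => gj_step M' j) M.

Lemma gj_run_solves u M r : gj_inv u M 0 -> (r < n)%N -> gj_run M n r n = u r.
Proof.
move=> inv0 rn.
have inv k : (k <= n)%N -> gj_inv u (gj_run M k) k.
  by elim: k => [//|k IH kn]; apply: gj_inv_step => //; exact/IH/ltnW.
by have [/(_ r rn)] := inv n (leqnn n); rewrite rn big_geq// addr0.
Qed.

End gauss_jordan.

Section solve.
Context {R : realType}.

Lemma gj_inv0 n (T : 'M[R]_n) (b : 'cV[R]_n) (M : nat -> nat -> R)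
    (u : nat -> R) :
  posdefmx T -> (forall r c : 'I_n, M r c = T r c) ->
  (forall r : 'I_n, M r n = b r 0) ->
  T *m (\col_(r < n) u r) = b -> gj_inv n u M 0.
Proof.
move=> [symT posT] ME bE sol; split.
- move=> r rn; rewrite add0r big_mkord (bE (Ordinal rn)) -sol mxE.
  by apply: eq_bigr => c _; rewrite mxE (ME (Ordinal rn)).
- move=> r c /= rn cn.
  rewrite (ME (Ordinal rn) (Ordinal cn)) (ME (Ordinal cn) (Ordinal rn)).
  by rewrite -{1}symT mxE.
- move=> x [c /= cn xc]; have x0 : \col_(r < n) x r != 0.
    apply: contraNneq xc => /matrixP/(_ (Ordinal cn) 0).
    by rewrite !mxE => /= ->.
  have := posT _ x0; congr (0 < _); rewrite /trailing_form big_mkord mxE.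
  under eq_bigr do rewrite mxE mulr_suml.
  rewrite exchange_big /=; apply: eq_bigr => r _; rewrite big_mkord.
  by apply: eq_bigr => c' _; rewrite !mxE ME.
Qed.

End solve.

(** * The program and its run *)

(** Register 0 counts the output cells of the previous columns, register 1 is
the current column, register 2 its number n of entries, register 3 the sum of
registers 0 and 2, and registers 4 to 6 are loop counters. The scratch matrix
has n + 1 rows and columns and starts right after the output of the current
column; the next column overwrites it. *)
Definition entry_addr (r c : iexp) : iexp :=
  IAdd (IReg 3) (IAdd (IMul r (IAdd (IReg 2) (ICst 1))) c).

Definition pivot_width : iexp := ISub (IReg 2) (IReg 4).
Definition right_of_pivot : iexp := IAdd (IAdd (IReg 4) (IReg 5)) (ICst 1).

Definition load_system : cmd :=
  CSeq (CFor 4 (IReg 2)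
    (CSeq (CFor 5 (IReg 2) (CMem (entry_addr (IReg 4) (IReg 5))
             (RTheta (IRow (IReg 1) (IReg 4)) (IRow (IReg 1) (IReg 5)))))
          (CMem (entry_addr (IReg 4) (IReg 2)) (RCst 0))))
    (CMem (entry_addr (ICst 0) (IReg 2)) (RCst 1)).

(** There is no test that could skip the pivot row during the elimination.
This row is therefore eliminated like the others, which clears it, and
restored from the normalized copy that has been saved in row n. *)
Definition eliminate_pivot : cmd :=
  CSeq (CFor 5 pivot_width (CMem (entry_addr (IReg 2) right_of_pivot)
         (RDiv (RMem (entry_addr (IReg 4) right_of_pivot))
               (RMem (entry_addr (IReg 4) (IReg 4))))))
  (CSeq (CFor 6 (IReg 2)
           (CFor 5 pivot_width (CMem (entry_addr (IReg 6) right_of_pivot)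
             (RSub (RMem (entry_addr (IReg 6) right_of_pivot))
                   (RMul (RMem (entry_addr (IReg 6) (IReg 4)))
                         (RMem (entry_addr (IReg 2) right_of_pivot)))))))
        (CFor 5 pivot_width (CMem (entry_addr (IReg 4) right_of_pivot)
           (RMem (entry_addr (IReg 2) right_of_pivot))))).

Definition store_column : cmd :=
  CFor 4 (IReg 2) (CMem (IAdd (IReg 0) (IReg 4))
    (RDiv (RMem (entry_addr (IReg 4) (IReg 2)))
          (RSqrt (RMem (entry_addr (ICst 0) (IReg 2)))))).

Definition column_cmd : cmd :=
  CSeq (CReg 2 (ISize (IReg 1)))
  (CSeq (CReg 3 (IAdd (IReg 0) (IReg 2)))
  (CSeq load_system
  (CSeq (CFor 4 (IReg 2) eliminate_pivot)
  (CSeq store_column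
        (CReg 0 (IAdd (IReg 0) (IReg 2))))))).

Definition factor_cmd : cmd := CFor 1 IDim column_cmd.

(** Bounds the time of each assignment of the program, including the update of
the loop counter. *)
Definition assign_cost : nat := 64%N.

Section program.
Context {R : realType}.
Variables (N : nat) (Theta : 'M[R]_N) (S : {set 'I_N * 'I_N}).
Implicit Type st : state R.
Local Notation run := (run Theta S).
Local Notation ieval := (ieval S).
Local Notation reval := (reval Theta S).
Local Notation K := assign_cost.

Lemma for_ind (P : nat -> state R -> Prop) x e c st len :
  ieval (reg st) e = len ->
  P 0%N (tick st (icost e).+1) ->
  (forall j st', (j < len)%N -> P j st' ->
     P j.+1 (run c (set_reg st' x j 1))) ->
  P len (run (CFor x e c) st).
Proof.
move=> /= -> P0 Pstep.
suff gen m a st' : (a + m <= len)%N -> P a st' ->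
    P (a + m)%N (foldl (fun s k => run c (set_reg s x k 1)) st' (iota a m)).
  by have := gen len 0%N _ (leqnn _) P0; rewrite add0n.
elim: m a st' => [|m IH] a st' am Pa; first by rewrite addn0.
rewrite -addSnnS; apply: IH; first by rewrite addSnnS.
by apply: Pstep => //; rewrite (leq_trans _ am)// -addSnnS leq_addr.
Qed.

Section column.
Variables (o i n B : nat).
Hypothesis fitB : (o + n + n.+1 * n.+1 <= B)%N.
Implicit Type M : nat -> nat -> R.

(** M is the content of the scratch matrix and low that of the cells before
it. *)
Definition holds (low : nat -> R) M t st : Prop :=
  [/\ reg st 0 = o, reg st 1 = i, reg st 2 = n & reg st 3 = (o + n)%N] /\
  [/\ forall r c, (r <= n)%N -> (c <= n)%N ->
        cell st (o + n + (r * n.+1 + c))%N = M r c,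
      forall p, (p < o + n)%N -> cell st p = low p,
      (time_used st <= t)%N, (rspace st <= 7)%N & (mspace st <= B)%N].

Implicit Type low : nat -> R.

Lemma holds_ext low M M' t t' st : (t <= t')%N ->
  (forall r c, (r <= n)%N -> (c <= n)%N -> M r c = M' r c) ->
  holds low M t st -> holds low M' t' st.
Proof.
move=> tt' MM' [regs [cells lows tm rs ms]]; split=> //; split=> //.
  by move=> r c rn cn; rewrite -MM'// cells.
exact: leq_trans tt'.
Qed.

Lemma holds_tick low M t st a :
  holds low M t st -> holds low M (t + a) (tick st a).
Proof.
move=> [regs [cells lows tm rs ms]]; split=> //.
by split=> //=; rewrite leq_add2r.
Qed.

Lemma holds_reg low M t st x v a : (3 < x < 7)%N -> holds low M t st ->
  holds low M (t + a) (set_reg st x v a).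
Proof.
move=> /andP[x3 x7] [[r0 r1 r2 r3] [cells lows tm rs ms]]; split.
  by split=> /=; rewrite ltn_eqF// (leq_trans _ x3).
by split=> //=; [rewrite leq_add2r|rewrite geq_max rs].
Qed.

Lemma entry_inj r c r' c' : (c <= n)%N -> (c' <= n)%N ->
  (r * n.+1 + c == r' * n.+1 + c')%N = (r == r') && (c == c').
Proof.
move=> cn c'n; apply/eqP/andP => [h|[/eqP-> /eqP->]//].
have : (r = r')%N.
  have : ((r * n.+1 + c) %/ n.+1 = (r' * n.+1 + c') %/ n.+1)%N by rewrite h.
  by rewrite !divnMDl// !divn_small// !addn0.
by move=> rr'; move: h; rewrite rr' => /addnI ->.
Qed.

Lemma holds_mem low M t st a r c v w : (r <= n)%N -> (c <= n)%N ->
  a = (o + n + (r * n.+1 + c))%N -> holds low M t st ->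
  holds low (fun r' c' => if (r' == r) && (c' == c) then v else M r' c') (t + w)
    (Defs.set_mem st a v w).
Proof.
move=> rn cn aE [regs [cells lows tm rs ms]]; split=> //; split=> //=.
- move=> r' c' r'n c'n; rewrite aE eqn_add2l entry_inj//.
  by case: ifP => // _; exact: cells.
- by move=> p pon; rewrite ltn_eqF ?lows// aE ltn_addr.
- by rewrite leq_add2r.
- rewrite geq_max ms aE (leq_trans _ fitB)// -addnS leq_add2l.
  by rewrite mulSn addnC -addSn leq_add// leq_mul2r rn orbT.
Qed.

Lemma ieval_entry_addr low M t st re ce r c : holds low M t st ->
  ieval (reg st) re = r -> ieval (reg st) ce = c ->
  ieval (reg st) (entry_addr re ce) = (o + n + (r * n.+1 + c))%N.
Proof.
by move=> [[_ _ h2 h3] _] rE cE; rewrite /entry_addr /= rE cE h2 h3 addn1.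
Qed.

Lemma reval_entry low M t st re ce r c : holds low M t st ->
  ieval (reg st) re = r -> ieval (reg st) ce = c -> (r <= n)%N -> (c <= n)%N ->
  reval (reg st) (cell st) (RMem (entry_addr re ce)) = M r c.
Proof.
move=> hM rE cE rn cn; rewrite -[LHS]/(cell st (ieval (reg st) _)).
by rewrite (ieval_entry_addr hM rE cE); case: hM => _ [-> //].
Qed.

(** All inner loops on the scratch matrix fill a segment of one row, from
column c0 on, and preserve the outer counters q4 and q6. The assigned values
are assumed to be correct in every intermediate state, since the loops of the
elimination also read the matrix that they change. *)
Lemma row_loop e re ce V r0 c0 w q4 q6 (f : nat -> R) low M t st :
  let part j :=
    fun r c => if (r == r0) && (c0 <= c < c0 + j)%N then f c else M r c in
  holds low M t st -> reg st 4 = q4 -> reg st 6 = q6 ->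
  ieval (reg st) e = w -> (w <= n)%N -> (r0 <= n)%N -> (c0 + w <= n.+1)%N ->
  (icost e < K)%N -> (icost (entry_addr re ce) + rcost V < K - 1)%N ->
  (forall j t' st', (j < w)%N -> holds low (part j) t' st' ->
     reg st' 4 = q4 -> reg st' 6 = q6 -> reg st' 5 = j ->
     [/\ ieval (reg st') re = r0, ieval (reg st') ce = (c0 + j)%N &
         reval (reg st') (cell st') V = f (c0 + j)%N]) ->
  let st' := run (CFor 5 e (CMem (entry_addr re ce) V)) st in
  [/\ holds low (part w) (t + K * n.+1) st', reg st' 4 = q4 & reg st' 6 = q6].
Proof.
move=> part hM h4 h6 he wn r0n c0w ecost vcost step.
pose P j st' := [/\ holds low (part j) (t + K + K * j) st', reg st' 4 = q4
  & reg st' 6 = q6].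
suff [hw ? ?] : P w (run (CFor 5 e (CMem (entry_addr re ce) V)) st).
  split=> //; apply: holds_ext hw => //.
  by rewrite -addnA leq_add2l -mulnS leq_mul2l.
apply: (@for_ind P _ _ _ _ w) => //.
  split=> //; apply: holds_ext (holds_tick _ hM).
    by rewrite muln0 addn0 leq_add2l.
  by move=> r c rn cn; rewrite /part addn0; case: (leqP c0 c); rewrite ?andbF.
move=> j st' jw [hj h4' h6'].
have [//|r0E c0E VE] := step j (t + K + K * j + 1)%N (set_reg st' 5 j 1) jw _
  h4' h6' erefl.
  exact: holds_reg.
split=> //.
have hj' := @holds_reg _ _ _ _ 5 j 1 isT hj.
have aE := ieval_entry_addr hj' r0E c0E.
have c0jn : (c0 + j <= n)%N by rewrite -ltnS (leq_trans _ c0w)// ltn_add2l.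
apply: holds_ext (holds_mem _ _ r0n c0jn aE hj'); last first.
  move=> r c rn cn; rewrite VE /part addnS ltnS.
  case: (eqVneq r r0) => //= _; case: (eqVneq c (c0 + j)%N) => [->|cj].
    by rewrite leqnn leq_addr.
  by rewrite [(c <= _)%N]leq_eqVlt (negbTE cj).
have Kc : ((icost (entry_addr re ce) + rcost V).+2 <= K)%N by exact: vcost.
by rewrite mulnS [(K + K * j)%N]addnC; move: Kc; set x := icost _; lia.
Qed.

Lemma holds_low low M t st p v w : (p < o + n)%N -> holds low M t st ->
  holds [eta low with p |-> v] M (t + w) (Defs.set_mem st p v w).
Proof.
move=> pon [regs [cells lows tm rs ms]]; split=> //; split=> //=.
- move=> r c rn cn; rewrite gtn_eqF ?cells//.
  by rewrite (leq_trans pon)// leq_addr.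
- by move=> q qon; case: ifP => // _; exact: lows.
- by rewrite leq_add2r.
- by rewrite geq_max ms (leq_trans pon)// (leq_trans _ fitB)// leq_addr.
Qed.

Definition entries r c : R :=
  in_entry Theta (nth 0%N (in_row S i) r) (nth 0%N (in_row S i) c).

Lemma load_system_spec low M t st : holds low M t st ->
  exists M', [/\ holds low M' (t + 3 * K * (n.+1 * n.+1)) (run load_system st),
    forall r c, (r < n)%N -> (c < n)%N -> M' r c = entries r c &
    forall r, (r < n)%N -> M' r n = (r == 0%N)%:R].
Proof.
move=> hM.
pose P q st' := exists M', [/\ holds low M' (t + K + (K * n.+1 + K) * q) st',
    forall r c, (r < q)%N -> (c < n)%N -> M' r c = entries r c &
    forall r, (r < q)%N -> M' r n = 0].
rewrite /load_system.
set loop := CFor 4 _ _; set fin := CMem _ _.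
have [M' [hM' Mrc Mrn]] : P n (run loop st).
  apply: for_ind; first by case: hM => [[]].
    exists M; split=> //; apply: holds_ext (holds_tick _ hM) => //.
    by rewrite muln0 addn0 leq_add2l.
  move=> q st' qn [M1 [hM1 M1rc M1rn]].
  have h1 := @holds_reg _ _ _ _ 4 q 1 isT hM1.
  set s := set_reg st' 4 q 1 in h1.
  set fill := CFor 5 _ _ in @loop *.
  have [h2 s4 _] : [/\ holds low (fun r c => if (r == q) && (0 <= c < 0 + n)%N
        then entries q c else M1 r c)
      (t + K + (K * n.+1 + K) * q + 1 + K * n.+1) (run fill s),
      reg (run fill s) 4 = q & reg (run fill s) 6 = reg s 6].
    apply: (@row_loop _ _ _ _ q 0 n q) => //.
    - by case: h1 => [[]].
    - exact: ltnW.
    move=> j t' s1 jn [[r0 r1 r2 r3] _] r4 r6 r5.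
    by split=> //=; rewrite r1 r4 r5.
  rewrite -[run _ _]/(run (CMem (entry_addr (IReg 4) (IReg 2)) (RCst 0))
    (run fill s)).
  set s2 := run fill s in h2 s4 *.
  have s22 : reg s2 2 = n by case: h2 => [[]].
  have aE := @ieval_entry_addr _ _ _ _ (IReg 4) (IReg 2) q n h2 s4 s22.
  eexists; split.
  - apply: holds_ext (holds_mem _ _ (ltnW qn) (leqnn n) aE h2); last by [].
    rewrite mulnS /assign_cost /=; nia.
  - move=> r c; rewrite ltnS leq_eqVlt /= => /orP[/eqP->|rq] cn.
      by rewrite eqxx (ltn_eqF cn) cn.
    by rewrite (ltn_eqF rq) /= M1rc.
  - move=> r; rewrite ltnS leq_eqVlt /= => /orP[/eqP->|rq].
      by rewrite !eqxx.
    by rewrite (ltn_eqF rq) /= M1rn.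
rewrite -[run _ _]/(run fin (run loop st)).
set s2 := run loop st in hM' *.
have s22 : reg s2 2 = n by case: hM' => [[]].
have aE := @ieval_entry_addr _ _ _ _ (ICst 0) (IReg 2) 0 n hM' erefl s22.
eexists; split.
- apply: holds_ext (holds_mem _ _ (leq0n n) (leqnn n) aE hM'); last by [].
  have : (n.+1 <= n.+1 * n.+1)%N by rewrite leq_pmulr.
  rewrite /= /K; nia.
- by move=> r c rn cn /=; rewrite (ltn_eqF cn) andbF Mrc.
- by move=> r rn /=; rewrite eqxx andbT; case: eqP => // _; rewrite Mrn.
Qed.

Lemma eliminate_pivot_spec low M t st k : (k < n)%N -> holds low M t st ->
  reg st 4 = k ->
  holds low (gj_step n M k) (t + 5 * K * (n.+1 * n.+1))
    (run eliminate_pivot st).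
Proof.
move=> kn hM st4; rewrite /eliminate_pivot.
set c1 := CFor 5 _ _; set c2 := CFor 6 _ _; set c3 := CFor 5 _ _.
rewrite -[run _ _]/(run c3 (run c2 (run c1 st))).
have widthE (s : state R) : reg s 2 = n -> reg s 4 = k ->
    ieval (reg s) pivot_width = (n - k)%N.
  by move=> s2 s4; rewrite /= s2 s4.
have rightE (s : state R) j : reg s 4 = k -> reg s 5 = j ->
    ieval (reg s) right_of_pivot = (k.+1 + j)%N.
  by move=> s4 s5; rewrite /= s4 s5 addn1 addSn.
have knE : (k.+1 + (n - k))%N = n.+1 by rewrite addSn subnKC// ltnW.
have hwn : (n - k <= n)%N := leq_subr k n.
pose M1 (r c : nat) :=
  if (r == n) && (k.+1 <= c < k.+1 + (n - k))%N then M k c / M k k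
  else M r c.
have [h1 s14 _] : [/\ holds low M1 (t + K * n.+1) (run c1 st),
      reg (run c1 st) 4 = k
    & reg (run c1 st) 6 = reg st 6].
  apply: row_loop => //.
  - by apply: widthE => //; case: hM => [[]].
  - by rewrite knE.
  move=> j t' s jw hs s4 s6 s5; have sR := rightE s j s4 s5.
  have jn : (k.+1 + j <= n)%N by rewrite addSn -ltn_subRL.
  split=> //; first by case: hs => [[]].
  rewrite -[LHS]/(
    reval (reg s) (cell s) (RMem (entry_addr (IReg 4) right_of_pivot)) /
    reval (reg s) (cell s) (RMem (entry_addr (IReg 4) (IReg 4)))).
  have e4 : ieval (reg s) (IReg 4) = k by [].
  rewrite (reval_entry hs e4 sR (ltnW kn) jn).
  rewrite (reval_entry hs e4 e4 (ltnW kn) (ltnW kn)).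
  by rewrite (ltn_eqF kn).
set st1 := run c1 st in h1 s14 *.
pose M2 (q r c : nat) := if (r < q)%N && (k < c)%N then M1 r c - M1 r k * M1 n c
  else M1 r c.
have [h2 s24] : holds low (M2 n) (t + K * n.+1 + K + (1 + K * n.+1) * n)
      (run c2 st1) /\
    reg (run c2 st1) 4 = k.
  pose P q s :=
    holds low (M2 q) (t + K * n.+1 + K + (1 + K * n.+1) * q) s /\ reg s 4 = k.
  apply: (@for_ind P); [by case: h1 => [[]]| |].
    split=> //; apply: holds_ext (holds_tick _ h1) => //.
    by rewrite muln0 addn0 leq_add2l.
  move=> q s qn [hs s4].
  have hs' := @holds_reg _ _ _ _ 6 q 1 isT hs.
  set s' := set_reg s 6 q 1 in hs' *.
  set c4 := CFor 5 _ _.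
  pose M3 (r c : nat) := if (r == q) && (k.+1 <= c < k.+1 + (n - k))%N
    then M1 q c - M1 q k * M1 n c else M2 q r c.
  have [h3 s34 _] : [/\ holds low M3
        (t + K * n.+1 + K + (1 + K * n.+1) * q + 1 + K * n.+1)
      (run c4 s'), reg (run c4 s') 4 = k & reg (run c4 s') 6 = q].
    apply: row_loop => //.
    - by apply: widthE => //; case: hs' => [[]].
    - exact: ltnW.
    - by rewrite knE.
    move=> j t' s1 jw hs1 s14' s16 s15; have sR := rightE s1 j s14' s15.
    have jn : (k.+1 + j <= n)%N by rewrite addSn -ltn_subRL.
    split=> //.
    have s12 : reg s1 2 = n by case: hs1 => [[]].
    rewrite -[LHS]/(
      reval (reg s1) (cell s1) (RMem (entry_addr (IReg 6) right_of_pivot)) -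
      reval (reg s1) (cell s1) (RMem (entry_addr (IReg 6) (IReg 4))) *
      reval (reg s1) (cell s1) (RMem (entry_addr (IReg 2) right_of_pivot))).
    have e6 : ieval (reg s1) (IReg 6) = q by [].
    have e4 : ieval (reg s1) (IReg 4) = k by [].
    have e2 : ieval (reg s1) (IReg 2) = n by [].
    rewrite (reval_entry hs1 e6 sR (ltnW qn) jn).
    rewrite (reval_entry hs1 e6 e4 (ltnW qn) (ltnW kn)).
    rewrite (reval_entry hs1 e2 sR (leqnn n) jn).
    have nq : (n < q)%N = false by rewrite ltnNge (ltnW qn).
    by rewrite (gtn_eqF qn) !ltnn !andbF /M2 !ltnn nq.
  split=> //; apply: holds_ext h3; first by rewrite mulnS; lia.
  move=> r c rn cn; rewrite /M3 /M2 knE ltnS cn andbT ltnS.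
  rewrite [(r <= q)%N]leq_eqVlt.
  by case: (eqVneq r q) => [->|rq] //=; rewrite ltnn; case: ifP.
set st2 := run c2 st1 in h2 s24 *.
pose M3 (r c : nat) :=
  if (r == k) && (k.+1 <= c < k.+1 + (n - k))%N then M2 n n c
  else M2 n r c.
have [h3 s34 _] : [/\ holds low M3
      (t + K * n.+1 + K + (1 + K * n.+1) * n + K * n.+1)
    (run c3 st2), reg (run c3 st2) 4 = k & reg (run c3 st2) 6 = reg st2 6].
  apply: row_loop => //.
  - by apply: widthE => //; case: h2 => [[]].
  - exact: ltnW.
  - by rewrite knE.
  move=> j t' s jw hs s4 s6 s5; have sR := rightE s j s4 s5.
  have jn : (k.+1 + j <= n)%N by rewrite addSn -ltn_subRL.
  have e2 : ieval (reg s) (IReg 2) = n by case: hs => [[]].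
  split=> //; rewrite (reval_entry hs e2 sR (leqnn n) jn).
  by rewrite (gtn_eqF kn).
apply: holds_ext h3.
  have : (n.+1 <= n.+1 * n.+1)%N by rewrite leq_pmulr.
  by rewrite /assign_cost; nia.
move=> r c rn cn; rewrite /M3 /M2 /M1 /gj_step knE !ltnS cn !andbT ltnn /=.
have [kc|ck] := ltnP k c; rewrite ?andbF ?andbT//.
rewrite (eqxx n) /=.
have [->|rk] := eqVneq r k; first by rewrite orbT.
rewrite orbF; move: rn; rewrite leq_eqVlt => /orP[/eqP->|rn].
  by rewrite ltnn eqxx.
by rewrite rn (ltn_eqF rn) ltnn.
Qed.

Lemma elimination_spec low M t st : holds low M t st ->
  holds low (gj_run n M n) (t + 7 * K * (n.+1 * n.+1 * n.+1))
    (run (CFor 4 (IReg 2) eliminate_pivot) st).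
Proof.
move=> hM.
pose T := (5 * K * (n.+1 * n.+1))%N.
pose P q s := holds low (gj_run n M q) (t + K + (T + 1) * q) s.
have : P n (run (CFor 4 (IReg 2) eliminate_pivot) st).
  apply: for_ind; first by case: hM => [[]].
    apply: holds_ext (holds_tick _ hM) => //.
    by rewrite muln0 addn0 leq_add2l.
  move=> q s qn hs; have hs' := @holds_reg _ _ _ _ 4 q 1 isT hs.
  apply: holds_ext (eliminate_pivot_spec qn hs' _) => //.
  by rewrite mulnS /T; lia.
apply: holds_ext => //; rewrite /T.
have : (1 <= n.+1 * n.+1)%N by [].
move: (n.+1 * n.+1)%N => m m0; rewrite /assign_cost; nia.
Qed.

Lemma store_column_spec low M t st : holds low M t st ->
  let st' := run store_column st in
  [/\ [/\ reg st' 0 = o, reg st' 1 = i & reg st' 2 = n],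
      forall p, (p < o)%N -> cell st' p = low p,
      forall j, (j < n)%N -> cell st' (o + j)%N = M j n / Num.sqrt (M 0%N n) &
      [/\ (time_used st' <= t + K * n.+1)%N, (rspace st' <= 7)%N
        & (mspace st' <= B)%N]].
Proof.
move=> hM.
pose f j := M j n / Num.sqrt (M 0%N n).
pose lowj j p := if (o <= p < o + j)%N then f (p - o)%N else low p.
pose P j s := exists2 low', holds low' M (t + K + K * j) s &
  forall p, (p < o + n)%N -> low' p = lowj j p.
have [low' [[r0 r1 r2 r3] [cells lows tm rs ms]] low'E] :
    P n (run store_column st).
  apply: for_ind; first by case: hM => [[]].
    exists low; last first.
      by move=> p _; rewrite /lowj addn0; case: (leqP o p).
    apply: holds_ext (holds_tick _ hM) => //.
    by rewrite muln0 addn0 leq_add2l.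
  move=> j s jn [low' hs low'E].
  have hs' := @holds_reg _ _ _ _ 4 j 1 isT hs.
  set s' := set_reg s 4 j 1 in hs' *.
  have e0 : ieval (reg s') (IAdd (IReg 0) (IReg 4)) = (o + j)%N.
    by case: hs' => [[h0 _ _ _] _]; rewrite -h0.
  have e4 : ieval (reg s') (IReg 4) = j by [].
  have e2 : ieval (reg s') (IReg 2) = n by case: hs' => [[]].
  have e00 : ieval (reg s') (ICst 0) = 0%N by [].
  have vE : reval (reg s') (cell s') (RDiv (RMem (entry_addr (IReg 4) (IReg 2)))
      (RSqrt (RMem (entry_addr (ICst 0) (IReg 2))))) = f j.
    rewrite -[LHS]/(
      reval (reg s') (cell s') (RMem (entry_addr (IReg 4) (IReg 2))) /
      Num.sqrt (reval (reg s') (cell s')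
        (RMem (entry_addr (ICst 0) (IReg 2))))).
    rewrite (reval_entry hs' e4 e2 (ltnW jn) (leqnn n)).
    by rewrite (reval_entry hs' e00 e2 (leq0n n) (leqnn n)).
  set w := ((icost (IAdd (IReg 0) (IReg 4)) + rcost (RDiv
    (RMem (entry_addr (IReg 4) (IReg 2)))
      (RSqrt (RMem (entry_addr (ICst 0) (IReg 2)))))).+1)%N.
  have oj : (o + j < o + n)%N by rewrite ltn_add2l.
  exists [eta low' with (o + j)%N |-> f j].
    rewrite -[run _ _]/(
      Defs.set_mem s' (ieval (reg s') (IAdd (IReg 0) (IReg 4)))
      (reval (reg s') (cell s') (RDiv (RMem (entry_addr (IReg 4) (IReg 2)))
      (RSqrt (RMem (entry_addr (ICst 0) (IReg 2)))))) w).
    rewrite e0 vE; apply: holds_ext (holds_low _ _ oj hs') => //.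
    by rewrite mulnS /w /= /assign_cost; lia.
  move=> p pon; rewrite /= low'E// /lowj addnS ltnS.
  case: eqVneq => [->|pj]; first by rewrite leq_addr leqnn addKn.
  by rewrite [(p <= o + j)%N]leq_eqVlt (negbTE pj).
move=> st'; split=> //.
- move=> p po.
  by rewrite lows ?low'E ?(leq_trans po) ?leq_addr// /lowj leqNgt po.
- move=> j jn; rewrite lows ?low'E ?ltn_add2l//.
  by rewrite /lowj leq_addr ltn_add2l jn /= addKn.
- by split=> //; apply: leq_trans tm _; rewrite mulnS addnA.
Qed.

End column.

(** M is the loaded system; its row n is whatever the cells contained. *)
Lemma column_spec B st o i n :
  reg st 0 = o -> reg st 1 = i -> n = size (in_row S i) ->
  (o + n + n.+1 * n.+1 <= B)%N -> (rspace st <= 7)%N -> (mspace st <= B)%N ->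
  let st' := run column_cmd st in
  exists M, [/\ [/\ forall r c, (r < n)%N -> (c < n)%N -> M r c = entries i r c
      & forall r, (r < n)%N -> M r n = (r == 0%N)%:R],
    reg st' 0 = (o + n)%N,
    forall p, (p < o)%N -> cell st' p = cell st p,
    forall j, (j < n)%N -> cell st' (o + j)%N =
      gj_run n M n j n / Num.sqrt (gj_run n M n 0%N n) &
    [/\ (time_used st' <= time_used st + 13 * K * (n.+1 * n.+1 * n.+1))%N,
      (rspace st' <= 7)%N & (mspace st' <= B)%N]].
Proof.
move=> st0 st1 nE fitB rs ms.
set st2 := run (CReg 3 (IAdd (IReg 0) (IReg 2)))
  (run (CReg 2 (ISize (IReg 1))) st).
have hM : holds o i n B (cell st)
    (fun r c => cell st (o + n + (r * n.+1 + c))%N)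
    (time_used st + K) st2.
  split; first by rewrite /st2 /= st0 st1 -nE.
  split=> //=.
  - by rewrite /assign_cost; lia.
  - by rewrite !geq_max rs.
have [M [hM1 Mrc Mrn]] := load_system_spec fitB hM.
have hM2 := elimination_spec fitB hM1.
have [[r0 r1 r2] lows outs [tm rs' ms']] := store_column_spec fitB hM2.
rewrite -[run _ _]/(run (CReg 0 (IAdd (IReg 0) (IReg 2))) (run store_column
  (run (CFor 4 (IReg 2) eliminate_pivot) (run load_system st2)))).
set st3 := run store_column _ in r0 r1 r2 lows outs tm rs' ms' *.
exists M; split=> //=.
- by rewrite r0 r2.
- split=> //; last by rewrite geq_max rs'.
  have : (1 <= n.+1 * n.+1)%N by [].
  by move: tm; move: (n.+1 * n.+1)%N => m; rewrite /assign_cost; nia.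
Qed.

End program.

(** * The factor computed by the program *)

Section factor.
Context {R : realType} (N : nat) (Theta : 'M[R]_N) (S : {set 'I_N * 'I_N}).
Hypotheses (pT : posdefmx Theta) (lS : lower_sparsity S).
Local Notation run := (run Theta S).

Lemma size_in_row (i : 'I_N) : size (in_row S i) = #|scol S i|.
Proof. by rewrite /in_row valK size_map -cardE. Qed.

Lemma nth_in_row (i : 'I_N) (k : 'I_#|scol S i|) :
  nth 0%N (in_row S i) k = enum_val k.
Proof.
rewrite /in_row valK (nth_map i) -?cardE//.
by rewrite (enum_val_nth i).
Qed.

Lemma entries_submx (i : 'I_N) (r c : 'I_#|scol S i|) :
  entries Theta S i r c = submx_set Theta (scol S i) r c.
Proof. by rewrite /entries !nth_in_row /in_entry !valK mxE. Qed.

(** The solution u of T u = e1 gives the direction of the column, and its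
first entry is e1^T T^-1 e1, the square of the normalization. *)
Lemma gj_run_KLcol (i : 'I_N) (M : nat -> nat -> R) (k : 'I_#|scol S i|) :
  let n := #|scol S i| in
  (forall r c, (r < n)%N -> (c < n)%N -> M r c = entries Theta S i r c) ->
  (forall r, (r < n)%N -> M r n = (r == 0%N)%:R) ->
  gj_run n M n k n / Num.sqrt (gj_run n M n 0%N n) = KLcol Theta S i k 0.
Proof.
move=> n Mrc Mrn; have n0 : (0 < n)%N by exact: scol_gt0.
pose T := submx_set Theta (scol S i).
have pTi : posdefmx T by exact: posdefmx_submx.
pose v : 'cV[R]_n := invmx T *m e1 n.
pose u r := if insub r is Some r' then v r' 0 else 0.
have uE (r : 'I_n) : u r = v r 0 by rewrite /u valK.
have vE : \col_(r < n) u r = v.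
  by apply/matrixP => r c; rewrite mxE uE (ord1 c).
have inv0 : gj_inv n u M 0.
  apply: (@gj_inv0 _ n T (e1 n)) => //.
  - by move=> r c; rewrite Mrc// entries_submx.
  - by move=> r; rewrite Mrn// mxE.
  - by rewrite vE mulKVmx// posdefmx_unit.
rewrite !(gj_run_solves inv0)// uE -[u 0%N]/(u (Ordinal n0)) uE.
by rewrite /KLcol [RHS]mxE -mulmxA e1_mulmx mulrC.
Qed.

Lemma sum_ltS (F : 'I_N -> nat) q (qN : (q < N)%N) :
  (\sum_(j < N | j < q.+1) F j = \sum_(j < N | j < q) F j + F (Ordinal qN))%N.
Proof.
rewrite (bigD1 (Ordinal qN)) ?ltnS//= addnC; congr (_ + _)%N.
by apply: eq_bigl => j; rewrite ltnS [RHS]ltn_neqAle andbC.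
Qed.

Lemma card_sparsity : #|S| = (\sum_(i < N) #|scol S i|)%N.
Proof.
rewrite -sum1_card.
under [RHS]eq_bigr do rewrite -sum1_card.
rewrite (exchange_big_dep xpredT)//= pair_big_dep /=.
by apply: eq_bigl => -[j i]; rewrite inE.
Qed.

Let m := (\max_(i < N) #|scol S i|)%N.
Let B := (#|S| + m.+1 * m.+1)%N.

Lemma factor_spec :
  let st := final Theta S factor_cmd in
  [/\ forall (i : 'I_N) (k : 'I_#|scol S i|),
        cell st (col_start S i + k)%N = KLcol Theta S i k 0,
      (time_used st <= 2 + \sum_(j < N)
         (1 + 13 * assign_cost *
           (#|scol S j|.+1 * #|scol S j|.+1 * #|scol S j|.+1)))%N,
      (rspace st <= 7)%N & (mspace st <= B)%N].
Proof.
pose w (j : 'I_N) :=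
  (1 + 13 * assign_cost * (#|scol S j|.+1 * #|scol S j|.+1 * #|scol S j|.+1))%N.
pose P q (st : state R) := [/\ reg st 0 = (\sum_(j < N | j < q) #|scol S j|)%N,
  forall (i : 'I_N) (k : 'I_#|scol S i|), (i < q)%N ->
        cell st (col_start S i + k)%N = KLcol Theta S i k 0,
  (time_used st <= 2 + \sum_(j < N | j < q) w j)%N,
  (rspace st <= 7)%N & (mspace st <= B)%N].
have [] : P N (final Theta S factor_cmd).
  apply: for_ind => //; first by split=> //=; rewrite big_pred0.
  move=> q st qN [r0 cells tm rs ms].
  set i := Ordinal qN; set st' := set_reg st 1 q 1.
  have nm : (#|scol S i| <= m)%N by exact: (leq_bigmax i).
  have oS : (\sum_(j < N | j < q) #|scol S j| + #|scol S i| <= #|S|)%N.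
    rewrite -sum_ltS card_sparsity.
    rewrite [leqRHS](bigID (fun j : 'I_N => (j < q.+1)%N))/=.
    exact: leq_addr.
  have [||||||M [[Mrc Mrn] r0' lows outs [tm' rs' ms']]] :=
    @column_spec _ _ Theta S B st'
      (\sum_(j < N | j < q) #|scol S j|)%N i #|scol S i|.
  - by [].
  - by [].
  - by rewrite size_in_row.
  - by rewrite leq_add// leq_mul.
  - by rewrite /= geq_max rs.
  - by [].
  split=> //.
  - by rewrite r0' (sum_ltS _ qN).
  - move=> i' k; rewrite ltnS leq_eqVlt => /orP[/eqP i'q|i'q].
      have ii' : i' = i by exact: val_inj.
      move: k; rewrite ii' => k; rewrite outs//.
      exact: gj_run_KLcol.
    rewrite lows; first exact: cells.
    rewrite (@leq_trans (\sum_(j < N | j < i'.+1) #|scol S j|)%N)//.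
      rewrite (sum_ltS _ (ltn_ord i')) (_ : Ordinal _ = i') ?ltn_add2l//.
      exact: val_inj.
    rewrite [leqRHS](bigID (fun j : 'I_N => (j < i'.+1)%N))/=.
    rewrite (eq_bigl (fun j : 'I_N => (j < q)%N && (j < i'.+1)%N)) => [|j].
      exact: leq_addr.
    by rewrite andbC; case: ltnP => // ji'; rewrite (leq_ltn_trans _ i'q).
  - rewrite (sum_ltS _ qN); apply: leq_trans tm' _.
    by rewrite -[leqLHS]addnA [leqRHS]addnA leq_add.
rewrite (eq_bigl xpredT) => [|j]; last by rewrite ltn_ord.
move=> _ cells; rewrite (eq_bigl xpredT) => [|j]; last by rewrite ltn_ord.
move=> tm rs ms; split=> // i k; exact: cells.
Qed.

End factor.

(** * The minimizer and the cost of computing it *)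

Theorem theorem2p1 (R : realType) :
  (forall (N : nat) (Theta : 'M[R]_N) (S : {set 'I_N * 'I_N}),
     posdefmx Theta -> lower_sparsity S ->
     [/\ (exists L, KLargmin Theta S L /\ forall i, 0 < L i i),
         (forall L, KLargmin Theta S L -> (forall i, 0 < L i i) ->
            forall i, subcol L (scol S i) i = KLcol Theta S i)
       & (forall L L', KLargmin Theta S L ->
            (KLargmin Theta S L' <->
             exists s : 'I_N -> bool,
               L' = L *m diag_mx (\row_i (-1) ^+ s i)))]) /\
  (exists (p : cmd) (C : nat),
     forall (N : nat) (Theta : 'M[R]_N) (S : {set 'I_N * 'I_N}) (L : 'M[R]_N),
       (0 < N)%N -> posdefmx Theta -> lower_sparsity S ->
       KLargmin Theta S L -> (forall i, 0 < L i i) ->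
       [/\ stores S (final Theta S p) L,
           (space_used (final Theta S p) <=
              C * (#|S| + (\max_(i < N) #|scol S i|) ^ 2))%N
         & (time_used (final Theta S p) <= C * \sum_(i < N) #|scol S i| ^ 3)%N]).
Proof.
split=> [N Theta S pT lS|].
  split.
  - exists (optmx Theta S); split; first exact: optmx_KLargmin.
    by move=> i; exact: optmx_diag_gt0.
  - exact: KLargmin_subcol.
  - exact: KLargmin_signs.
exists factor_cmd, (13 * 8 * assign_cost + 3)%N.
move=> N Theta S L N0 pT lS minL L_gt0.
have [cells tm rs ms] := factor_spec pT lS.
have size_gt0 i : (0 < #|scol S i|)%N by exact: scol_gt0.
split.
- move=> i k; rewrite cells -(KLargmin_subcol pT lS minL L_gt0).
  by rewrite mxE.
- set m := (\max_(i < N) _)%N in ms *.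
  have m_gt0 : (0 < m)%N.
    exact: leq_trans (size_gt0 (Ordinal N0)) (leq_bigmax (Ordinal N0)).
  rewrite /space_used; apply: leq_trans (leq_add rs ms) _.
  by rewrite /assign_cost -mulnn; nia.
- apply: leq_trans tm _; rewrite big_distrr /=.
  have sum_gt0 : (1 <= \sum_(i < N) #|scol S i| ^ 3)%N.
    rewrite (bigD1 (Ordinal N0))//= (leq_trans _ (leq_addr _ _))//.
    by rewrite expn_gt0 size_gt0.
  apply: (@leq_trans
      (\sum_(i < N) (13 * 8 * assign_cost + 1) * #|scol S i| ^ 3 +
      2 * \sum_(i < N) #|scol S i| ^ 3)%N).
    rewrite addnC leq_add ?leq_pmulr// leq_sum// => i _.
    have := size_gt0 i; move: #|scol S i| => n n_gt0.
    (* (n + 1)^3 <= 8 n^3, as n >= 1 *)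
    have le8 : (n.+1 * n.+1 * n.+1 <= 8 * n ^ 3)%N.
      have h : (n.+1 <= 2 * n)%N by lia.
      have -> : (8 * n ^ 3 = 2 * n * (2 * n) * (2 * n))%N.
        by rewrite !expnS; lia.
      by rewrite !leq_mul.
    have n3 : (1 <= n ^ 3)%N by rewrite expn_gt0 n_gt0.
    rewrite mulnDl mul1n addnC leq_add//.
    have -> : (13 * 8 * assign_cost * n ^ 3 = 13 * assign_cost * (8 * n ^ 3))%N.
      by rewrite mulnA (mulnAC 13).
    by rewrite leq_mul2l le8 orbT.
  rewrite big_distrr -big_split /=; apply: leq_sum => i _.
  by rewrite -mulnDl -addnA.
Qed.
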